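(* The shifted multigraded dimension of $W_L^T$ is $$\chi'(\mathbf x;q)=\sum_{\mathbf m\in(\mathbb Z_{\ge0})^d}\frac{q^{\frac{\mathbf m^tA\mathbf m}{2}}}{(q^{\frac{k}{l_1}};q^{\frac{k}{l_1}})_{m_1}\cdots(q^{\frac{k}{l_d}};q^{\frac{k}{l_d}})_{m_d}}\,x_1^{m_1}\cdots x_d^{m_d},$$ where $A$ is the $(d\times d)$-matrix defined by $A_{i,j}=k\langle\alpha^{(i)}_{(0)},\alpha^{(j)}_{(0)}\rangle$.
   Context: **Lattice data.** $L=\mathbb{Z}\alpha_1\oplus\cdots\oplus\mathbb{Z}\alpha_D$ is a positive definite even lattice with symmetric $\mathbb{Z}$-bilinear form $\langle\cdot,\cdot\rangle$ such that $\langle\alpha_i,\alpha_j\rangle\ge 0$ for all $i,j$. $\nu:L\to L$ is an isometry of finite order $v$ permuting $\alpha_1,\dots,\alpha_D$; $k=2v$; $\eta\in\mathbb{C}$ is a primitive $k$-th root of unity, and for $r\mid k$ we put $\eta_r=\eta^{k/r}$. The permutation has $d$ cycles, of lengths $l_1,\dots,l_d$, and the basis is numbered so that $\nu=(1,\dots,l_1)(l_1+1,\dots,l_1+l_2)\cdots$; put $\alpha^{(r)}=\alpha_{l_1+\cdots+l_{r-1}+1}$ and $\alpha^{(r)}_j=\nu^{j-1}\alpha^{(r)}$ ($1\le j\le l_r$). Let $\mathfrak h=L\otimes_{\mathbb Z}\mathbb{C}$ with the extended form and extended $\nu$; $\mathfrak h_{(n)}=\{h:\nu h=\eta^n h\}$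 ($n\in\mathbb Z$), and $h_{(n)}$ is the projection of $h$ to $\mathfrak h_{(n)}$; in particular $h_{(0)}=\frac1k\sum_{j=0}^{k-1}\nu^jh$. Say $\alpha^{(i)}$ satisfies the *evenness condition* if $l_i$ is odd, or $l_i$ is even and $\langle\alpha^{(i)},\nu^{l_i/2}\alpha^{(i)}\rangle\in2\mathbb{Z}$. Put $N=\{\alpha\in L:\langle\alpha,\mathfrak h_{(0)}\rangle=0\}$, $M=(1-\nu)L$, $R=\{\alpha\in N: C_N(\alpha,\beta)=1\ \forall\beta\in N\}$ with $C_N(\alpha,\beta)=\eta^{\sum_{j=0}^{k-1}j\langle\nu^j\alpha,\beta\rangle}$. It is assumed that $N=M=R$. **Central extensions.** $\hat L$ is the central extension of $L$ by $\langle\eta\rangle$ with normalized section $\alpha\mapsto e_\alpha$ and $e_\alpha e_\beta=\epsilon(\alpha,\beta)e_{\alpha+\beta}$, where $\epsilon$ is bimultiplicative with $\epsilon(\alpha_i,\alpha_j)=1$ if $i\le j$ and $(-1)^{\langle\alpha_i,\alpha_j\rangle}$ if $i>j$; its commutator map is $(-1)^{\langle\alpha,\beta\rangle}$. $\hat\nu$ is the automorphism of $\hat L$ fixing $\eta$ such that, for $\alpha$ in the orbit of $\alpha^{(r)}$, $\hat\nu e_\alpha=e_{\nu\alpha}$ if $\alpha^{(r)}$ satisfies the evenness condition and $\hat\nu e_\alpha=\eta_{2l_r}e_{\nu\alpha}$ otherwise. $\hat L_\nu$ is the same set as $\hat L$ with product $\times_\nu$ determined by $a\times b=\prod_{0<j<k/2}(-\eta^j)^{\langle\nu^{-j}\bar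 a,\bar b\rangle}\,a\times_\nu b$ (bar is the projection to $L$); its commutator map is $C(\alpha,\beta)=\prod_{j=0}^{k-1}(-\eta^j)^{\langle\nu^j\alpha,\beta\rangle}$, and $\hat\nu$ is also an automorphism of $\hat L_\nu$. $\hat N\subset\hat L_\nu$ is the preimage of $N$, and $\tau:\hat N\to\mathbb C^\times$ is the unique homomorphism with $\tau(\eta)=\eta$ and $\tau(a\,\hat\nu a^{-1})=\eta^{-\frac12\sum_{j=0}^{k-1}\langle\nu^j\bar a,\bar a\rangle}$ for $a\in\hat L_\nu$. **Twisted module.** $\hat{\mathfrak h}[\nu]=\coprod_{n\in\frac1k\mathbb Z}\mathfrak h_{(kn)}\otimes t^n\oplus\mathbb C\mathbf k$ with $\mathbf k$ central and $[\alpha\otimes t^m,\beta\otimes t^n]=\langle\alpha,\beta\rangle m\delta_{m+n,0}\mathbf k$; write $\alpha(n)=\alpha\otimes t^n$. $S[\nu]$ is the $\hat{\mathfrak h}[\nu]$-module induced from the trivial module $\mathbb C$ of $\coprod_{n\ge0}\mathfrak h_{(kn)}\otimes t^n$, with $\mathbf k=1$. $U_T=\mathbb C[\hat L_\nu]\otimes_{\mathbb C[\hat N]}\mathbb C_\tau\cong\mathbb C[L/N]$. $V_L^T=S[\nu]\otimes U_T$: $\hat L_\nu$ acts on $U_T$ by left multiplication, and for $h\in\mathfrak h_{(0)}$ the operator $x^h$ acts on $b\otimes1\in U_T$ by $x^{\langle h,\bar b\rangle}$. Put $1_T=1\otimes(1\otimes1)$. For $\alpha\in L$, $$E^\pm(-\alpha,x)=\exp\Big(\sum_{n\in\pm\frac1k\mathbb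 Z_+}\frac{-\alpha_{(kn)}(n)}{n}x^{-n}\Big),\quad \sigma(\alpha)=\prod_{0<j<k/2}(1-\eta^{-j})^{\langle\nu^j\alpha,\alpha\rangle}\,2^{\langle\nu^{k/2}\alpha,\alpha\rangle/2},$$ $$Y^{\hat\nu}(e^\alpha,x)=k^{-\langle\alpha,\alpha\rangle/2}\sigma(\alpha)E^-(-\alpha,x)E^+(-\alpha,x)\,e_\alpha\,x^{\alpha_{(0)}+\frac{\langle\alpha_{(0)},\alpha_{(0)}\rangle}{2}-\frac{\langle\alpha,\alpha\rangle}{2}}=\sum_{m\in\frac1k\mathbb Z}(e^\alpha)^{\hat\nu}_m x^{-m-\langle\alpha,\alpha\rangle/2}.$$ These are the operators attached to $e^\alpha\in V_L$ in the $\hat\nu$-twisted module $V_L^T$ for the lattice vertex operator algebra $V_L$. **Principal subspace.** $W_L\subset V_L$ is the vertex subalgebra generated by $e^{\alpha_1},\dots,e^{\alpha_D}$ and $W_L^T=W_L\cdot1_T\subset V_L^T$; concretely $W_L^T$ is the span of all $(e^{\alpha_{i_1}})^{\hat\nu}_{m_1}\cdots(e^{\alpha_{i_s}})^{\hat\nu}_{m_s}1_T$ with $s\ge0$, $m_j\in\frac1k\mathbb Z$. **Gradings.** $W_L^T$ is graded by $L^{\hat\nu}(0)$-weight, with $\mathrm{wt}(1_T)=\frac1{4k^2}\sum_{j=1}^{k-1}j(k-j)\dim\mathfrak h_{(j)}$ and $\mathrm{wt}\big((e^{\alpha_{i_1}})^{\hat\nu}_{m_1}\cdots(e^{\alpha_{i_s}})^{\hat\nu}_{m_s}1_T\big)=-(m_1+\cdots+m_s)+\mathrm{wt}(1_T)$,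 and by charge in $\mathbb Z_{\ge0}^d$: this vector has charge $(c_1,\dots,c_d)$ where $c_r$ is the number of indices $p$ with $\alpha_{i_p}$ in the $\nu$-orbit of $\alpha^{(r)}$. $(W_L^T)_{(\mathbf m,n)}$ is the space of $w\in W_L^T$ of charge $\mathbf m$ and with $k(\mathrm{wt}(w)-\mathrm{wt}(1_T))=n$. The shifted multigraded dimension is $$\chi'(\mathbf x;q)=\sum_{n\in\mathbb Z_{\ge0},\,\mathbf m\in\mathbb Z_{\ge0}^d}\dim(W_L^T)_{(\mathbf m,n)}\,q^n x_1^{m_1}\cdots x_d^{m_d}.$$ Notation: $(a;q)_n=(1-a)(1-aq)\cdots(1-aq^{n-1})$. *)

(* Defs.v *)
From HB Require Import structures.
From mathcomp Require Import all_boot all_order all_fingroup all_algebra.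
From mathcomp Require Import boolp classical_sets functions cardinality fsbigop.
From mathcomp Require Import finmap reals complex monalg.

Set Implicit Arguments.
Unset Strict Implicit.
Unset Printing Implicit Defensive.

Import Order.TTheory GRing.Theory Num.Theory.
Local Open Scope classical_set_scope.
Local Open Scope ring_scope.

(* The form with integer Gram matrix G: on L for A = int, and on
   h = L (x) C for A = C. *)
Definition bform (A : pzRingType) (D : nat) (G : 'M[int]_D) (a b : 'rV[A]_D) : A :=
  (a *m map_mx intr G *m b^T) 0 0.

(* The permutation s of the basis, extended linearly: delta_mx 0 i is sent to
   delta_mx 0 (s i). *)
Definition pact (A : pzRingType) (D : nat) (s : 'S_D) (a : 'rV[A]_D) : 'rV[A]_D :=
  a *m perm_mx s.

(* L is 'rV[int]_D with basis alpha_i = delta_mx 0 i and D = sumn len, where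
   len = (l_1, ..., l_d) lists the cycle lengths of nu.  The basis is numbered
   from 0, and nu_cycles says that nu is
   (0, ..., l_1 - 1) (l_1, ..., l_1 + l_2 - 1) ... *)
Record twisted_lattice := TwistedLattice {
  ncyc : nat;
  len : ncyc.-tuple nat;
  len_gt0 : forall r : 'I_ncyc, (0 < tnth len r)%N;
  gram : 'M[int]_(sumn len);
  gram_sym : gram^T = gram;
  gram_ge0 : forall i j, 0 <= gram i j;
  gram_even : forall a : 'rV[int]_(sumn len), (2 %| bform gram a a)%Z;
  gram_posdef : forall a : 'rV[int]_(sumn len), a != 0 -> 0 < bform gram a a;
  nu : 'S_(sumn len);
  nu_cycles : forall i, nu i = flatten_index len (reshape_index len i)
    ((reshape_offset len i).+1 %% nth 0 len (reshape_index len i)) :> nat;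
  nu_isometry : forall i j, gram (nu i) (nu j) = gram i j
}.

Section Lattice.

Variable X : twisted_lattice.

Definition rk : nat := sumn (len X).

Local Notation L := 'rV[int]_rk.

Definition nu_order : nat := #[nu X]%g.

Definition period : nat := nu_order.*2.

Definition latform (a b : L) : int := bform (gram X) a b.

Definition simple (i : 'I_rk) : L := delta_mx 0 i.

Lemma lead_proof (r : 'I_(ncyc X)) : (flatten_index (len X) r 0 < rk)%N.
Proof. by apply: flatten_indexP; rewrite -tnth_nth len_gt0. Qed.

(* alpha^(r) = simple (lead r) *)
Definition lead (r : 'I_(ncyc X)) : 'I_rk := Ordinal (lead_proof r).

Definition evenness_condition (r : 'I_(ncyc X)) : bool :=
  let l := tnth (len X) r in
  odd l || (2 %| latform (simple (lead r))
                         (pact (nu X ^+ l./2)%g (simple (lead r))))%Z.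

(* The group <eta> is cyclic of order k = period >= 2; it is written additively
   as 'Z_k, the class of s standing for eta^s, so that -1 is the class of
   k/2 = nu_order.  The pair (s, a) stands for eta^s e_a.  eps_exp is the exponent
   of the cocycle epsilon; nueps_exp is that of the cocycle of the product x_nu,
   obtained by dividing epsilon by the product of the
   (- eta^j)^<nu^(-j) a, b> for 0 < j < k/2. *)
Local Notation Zk := 'Z_period.

Definition eps_exp (a b : L) : Zk :=
  (\sum_(i < rk) \sum_(j < rk | (j < i)%N) nu_order%:Z * (a 0 i * gram X i j * b 0 j))%:~R.

Definition nueps_exp (a b : L) : Zk :=
  eps_exp a b
  - (\sum_(1 <= j < nu_order)
       (nu_order + j)%:Z * latform (pact (nu X ^- j)%g a) b)%:~R.

Lemma bformDl (A : pzRingType) D G (a b c : 'rV[A]_D) :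
  bform G (a + b) c = bform G a c + bform G b c.
Proof. by rewrite /bform !mulmxDl mxE. Qed.

Lemma bformDr (A : pzRingType) D G (a b c : 'rV[A]_D) :
  bform G a (b + c) = bform G a b + bform G a c.
Proof. by rewrite /bform linearD mulmxDr mxE. Qed.

Lemma eps_expDl a b c : eps_exp (a + b) c = eps_exp a c + eps_exp b c.
Proof.
rewrite /eps_exp -rmorphD -big_split /=; congr (_%:~R); apply: eq_bigr => i _.
rewrite -big_split /=; apply: eq_bigr => j _.
by rewrite mxE !mulrDl mulrDr.
Qed.

Lemma eps_expDr a b c : eps_exp a (b + c) = eps_exp a b + eps_exp a c.
Proof.
rewrite /eps_exp -rmorphD -big_split /=; congr (_%:~R); apply: eq_bigr => i _.
rewrite -big_split /=; apply: eq_bigr => j _.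
by rewrite mxE !mulrDr.
Qed.

Lemma nueps_expDl a b c : nueps_exp (a + b) c = nueps_exp a c + nueps_exp b c.
Proof.
rewrite /nueps_exp eps_expDl addrACA -opprD; congr (_ - _).
rewrite -rmorphD -big_split /=; congr (_%:~R); apply: eq_bigr => j _.
by rewrite /latform /pact mulmxDl bformDl mulrDr.
Qed.

Lemma nueps_expDr a b c : nueps_exp a (b + c) = nueps_exp a b + nueps_exp a c.
Proof.
rewrite /nueps_exp eps_expDr addrACA -opprD; congr (_ - _).
rewrite -rmorphD -big_split /=; congr (_%:~R); apply: eq_bigr => j _.
by rewrite /latform bformDr mulrDr.
Qed.

End Lattice.

Notation lattice X := 'rV[int]_(rk X).

(* The central extension of V by Z with bimultiplicative cocycle f. *)
Section CentralExtension.

Variables (Z V : zmodType) (f : V -> V -> Z).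
Hypothesis fDl : forall a b c, f (a + b) c = f a c + f b c.
Hypothesis fDr : forall a b c, f a (b + c) = f a b + f a c.

Definition ext_mul (x y : Z * V) : Z * V := (x.1 + y.1 + f x.2 y.2, x.2 + y.2).
Definition ext_inv (x : Z * V) : Z * V := (f x.2 x.2 - x.1, - x.2).

Lemma ext_f0 a : f 0 a = 0.
Proof. by apply: (@addrI _ (f 0 a)); rewrite -fDl !addr0. Qed.

Lemma ext_f0r a : f a 0 = 0.
Proof. by apply: (@addrI _ (f a 0)); rewrite -fDr !addr0. Qed.

Lemma ext_mulA : associative ext_mul.
Proof.
move=> [s a] [t b] [u c]; rewrite /ext_mul /= fDl fDr; congr pair; last exact: addrA.
rewrite -!addrA; congr (_ + (_ + _)); rewrite [RHS]addrCA; congr (_ + _).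
by rewrite addrC addrA.
Qed.

Lemma ext_mul1 : left_id (0, 0) ext_mul.
Proof. by move=> [s a]; rewrite /ext_mul /= ext_f0 !add0r addr0. Qed.

Lemma ext_mulr1 : right_id (0, 0) ext_mul.
Proof. by move=> [s a]; rewrite /ext_mul /= ext_f0r !addr0. Qed.

Lemma ext_mulV : left_inverse (0, 0) ext_inv ext_mul.
Proof.
move=> [s a]; rewrite /ext_mul /ext_inv /= addNr; congr pair.
by rewrite subrK -fDl addrC addNr ext_f0.
Qed.

Lemma ext_mulrV : right_inverse (0, 0) ext_inv ext_mul.
Proof.
move=> [s a]; rewrite /ext_mul /ext_inv /= subrr; congr pair.
by rewrite addrC [s + _]addrC subrK -fDr addNr ext_f0r.
Qed.

End CentralExtension.

(* hatLnu is the set hatL with the product x_nu. *)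
Definition hatL (X : twisted_lattice) : Type := 'Z_(period X) * lattice X.
Definition hatLnu (X : twisted_lattice) : Type := hatL X.

HB.instance Definition _ X := Choice.copy (hatL X) ('Z_(period X) * lattice X)%type.
HB.instance Definition _ X := Choice.copy (hatLnu X) ('Z_(period X) * lattice X)%type.

HB.instance Definition _ X := isGroup.Build (hatL X)
  (ext_mulA (@eps_expDl X) (@eps_expDr X))
  (ext_mul1 (@eps_expDl X)) (ext_mulr1 (@eps_expDr X))
  (ext_mulV (@eps_expDl X)) (ext_mulrV (@eps_expDr X)).

HB.instance Definition _ X := isGroup.Build (hatLnu X)
  (ext_mulA (@nueps_expDl X) (@nueps_expDr X))
  (ext_mul1 (@nueps_expDl X)) (ext_mulr1 (@nueps_expDr X))
  (ext_mulV (@nueps_expDl X)) (ext_mulrV (@nueps_expDr X)).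

Section HatL.

Variable X : twisted_lattice.

Definition bar (a : hatL X) : lattice X := a.2.

Definition sect (a : lattice X) : hatL X := (0, a).

(* eta^s as a central element, for s in Z/k *)
Definition central (s : 'Z_(period X)) : hatL X := (s, 0).

Definition is_nuhat (nuhat : hatL X -> hatL X) : Prop :=
  [/\ bijective nuhat,
      forall a b : hatL X, nuhat (a * b)%g = (nuhat a * nuhat b)%g,
      nuhat (central 1) = central 1 &
      forall (r : 'I_(ncyc X)) (i : 'I_(rk X)), i \in porbit (nu X) (lead r) ->
        nuhat (sect (simple i)) =
          if evenness_condition r then sect (pact (nu X) (simple i))
          else (central (period X %/ (2 * tnth (len X) r))%:R
                  * sect (pact (nu X) (simple i)))%g].

End HatL.

Section ExpSeries.

Variables (K : fieldType) (V : lmodType K) (A : nat -> V -> V).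

(* Coefficient of z^p in (\sum_(n >= 1) A n z^n)^j, applied to w. *)
Fixpoint pow_coef (j p : nat) (w : V) : V :=
  if j is j'.+1 then \sum_(1 <= n < p.+1) A n (pow_coef j' (p - n) w)
  else if p == 0%N then w else 0.

(* Coefficient of z^p in exp (\sum_(n >= 1) A n z^n), applied to w. *)
Definition exp_coef (p : nat) (w : V) : V :=
  \sum_(j < p.+1) (j`!%:R)^-1 *: pow_coef j p w.

End ExpSeries.

Section Dimension.

Variables (K : fieldType) (V : lmodType K).

Definition lin_span (A : set V) : set V :=
  [set w | exists (n : nat) (c : 'I_n -> K) (v : 'I_n -> V),
    (forall i, A (v i)) /\ w = \sum_(i < n) c i *: v i].

Definition has_dim (A : set V) (n : nat) : Prop :=
  exists b : 'I_n -> V, lin_span (range b) = A /\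
    forall c : 'I_n -> K, \sum_(i < n) c i *: b i = 0 -> forall i, c i = 0.

Definition finite_dim (A : set V) : Prop := exists n, has_dim A n.

(* Only meaningful when A is finite-dimensional. *)
Definition dim (A : set V) : nat := xget 0%N (has_dim A).

End Dimension.

Section Twisted.

Variables (R : realType) (X : twisted_lattice) (eta : R[i]).

Local Notation C := R[i].
Local Notation k := (period X).
Local Notation h := 'rV[C]_(rk X).

Definition toh (a : lattice X) : h := map_mx intr a.

Definition hform (a b : h) : C := bform (gram X) a b.

(* The rows of hspace n span h_(n). *)
Definition hspace (n : int) : 'M[C]_(rk X) :=
  eigenspace (perm_mx (nu X)) (eta ^ n).

(* The projection to h_(n) along the other eigenspaces: see hproj_sub and
   hproj_sum. *)
Definition hproj (n : int) (a : h) : h :=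
  k%:R^-1 *: \sum_(j < k) eta ^ (- (n * j%:Z)) *: pact (nu X ^+ j)%g a.

Lemma hproj_sub (n : int) (a : h) : eta ^+ k = 1 -> (hproj n a <= hspace n)%MS.
Proof.
move=> ek; have eta0 : eta != 0.
  apply: contra_eq_neq ek => ->; rewrite expr0n eq_sym.
  by rewrite (negPf (_ : period X != 0%N)) ?oner_eq0// double_eq0 -lt0n order_gt0.
apply/eigenspaceP; rewrite -scalemxAl scalerA mulrC -scalerA; congr (_ *: _).
rewrite mulmx_suml scaler_sumr.
pose G (j : nat) := eta ^ (n * (1 - j%:Z)) *: pact (nu X ^+ j)%g a.
have GE (j : nat) : eta ^ n *: (eta ^ (- (n * j%:Z)) *: pact (nu X ^+ j)%g a) = G j.
  by rewrite scalerA -expfzDr// /G mulrBr mulr1.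
have GS (j : nat) : (eta ^ (- (n * j%:Z)) *: pact (nu X ^+ j)%g a) *m perm_mx (nu X) = G j.+1.
  rewrite -scalemxAl -mulmxA -perm_mxM -expgSr; congr (_ ^ _ *: _).
  by rewrite intS opprD addrA subrr add0r mulrN.
have -> : \sum_(j < period X) (eta ^ (- (n * j%:Z)) *: pact (nu X ^+ j)%g a) *m perm_mx (nu X) = \sum_(j < period X) G j.+1.
  by apply: eq_bigr => j _; rewrite GS.
have -> : \sum_(j < period X) eta ^ n *: (eta ^ (- (n * j%:Z)) *: pact (nu X ^+ j)%g a) = \sum_(j < period X) G j.
  by apply: eq_bigr => j _; rewrite GE.
apply: (addrI (G 0%N)).
have -> : G 0%N + \sum_(i < period X) G i.+1 = \sum_(i < (period X).+1) G i.
  by rewrite big_ord_recl.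
rewrite big_ord_recr /= addrC; congr (_ + _).
rewrite /G.
have -> : (nu X ^+ period X)%g = (nu X ^+ 0)%g.
  by rewrite /period -muln2 expgM expg_order expg1n.
rewrite subr0 mulr1 mulrBr mulr1 expfzDr//.
suff -> : eta ^ (- (n * (period X)%:Z)) = 1 by rewrite mulr1.
by rewrite -mulNr mulrC -exprz_exp -exprnP ek exp1rz.
Qed.

Lemma hproj_sum (a : h) : k.-primitive_root eta ->
  \sum_(n < k) hproj n a = a.
Proof.
move=> prim; have ek := prim_expr_order prim.
have k0 := prim_order_gt0 prim.
have eta0 : eta != 0.
  by apply: contra_eq_neq ek => ->; rewrite expr0n eqn0Ngt k0 eq_sym oner_eq0.
have kn0 : (period X)%:R != 0 :> R[i] by rewrite pnatr_eq0 -lt0n.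
rewrite /hproj -scaler_sumr exchange_big /=.
under eq_bigr do rewrite -scaler_suml.
rewrite (bigD1 (Ordinal k0)) //= [X in _ + X]big1 ?addr0; last first.
  move=> j jn0.
  have w1 : eta ^- j != 1.
    rewrite invr_eq1 -(prim_order_dvd prim) gtnNdvd// lt0n.
    by apply: contra_neq jn0 => j0; apply: val_inj.
  rewrite (eq_bigr (fun i : 'I__ => (eta ^- j) ^+ i)); last first.
    by move=> i _; rewrite -exprVn -exprM mulnC -PoszM -exprnN exprVn.
  have /eqP := subrX1 (eta ^- j) (period X).
  have -> : (eta ^- j) ^+ period X = 1.
    by rewrite exprVn -exprM mulnC exprM ek expr1n invr1.
  rewrite subrr eq_sym.
  by rewrite mulf_eq0 subr_eq0 (negPf w1) => /eqP ->; rewrite scale0r.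
rewrite (eq_bigr (fun=> 1)); last by move=> i _; rewrite mulr0 oppr0 expr0z.
by rewrite sumr_const card_ord scalerA mulVf// scale1r /pact expg0 perm_mx1 mulmx1.
Qed.

Definition Nlat : set (lattice X) :=
  [set a | forall b : h, (b <= hspace 0)%MS -> hform (toh a) b = 0].

Definition Mlat : set (lattice X) := range (fun a => a - pact (nu X) a).

Definition commN (a b : lattice X) : C :=
  eta ^ (\sum_(j < k) j%:Z * latform (pact (nu X ^+ j)%g a) b).

Definition Rlat : set (lattice X) :=
  [set a | Nlat a /\ forall b, Nlat b -> commN a b = 1].

Definition hatN : set (hatLnu X) := [set a | Nlat (bar a)].

Definition is_tau (nuhat : hatL X -> hatL X) (tau : hatLnu X -> C) : Prop :=
  [/\ forall a, hatN a -> tau a != 0,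
      forall a b : hatLnu X, hatN a -> hatN b -> tau (a * b)%g = tau a * tau b,
      tau (central 1) = eta &
      forall a : hatLnu X, tau (a * (nuhat a : hatLnu X)^-1)%g =
        eta ^ (- ((\sum_(j < k) latform (pact (nu X ^+ j)%g (bar a)) (bar a))%R
                    %/ 2)%Z)].

(* S[nu] is the polynomial algebra on a basis of
   \bigoplus_(n > 0) h_(-n) (x) t^(-n/k): the variable (n, j) stands for
   b (-(n + 1)/k), with b the j-th row of row_base (hspace (-(n + 1))). *)
Definition fock_var : Type := {n : nat & 'I_(\rank (hspace (- n.+1%:Z)))}.

HB.instance Definition _ := Choice.copy fock_var
  {n : nat & 'I_(\rank (hspace (- n.+1%:Z)))}.

Local Notation fock := {malg C[{cmonom fock_var}]}.

Definition fvar (n : nat) (j : 'I_(\rank (hspace (- n.+1%:Z)))) : fock_var :=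
  existT _ n j.

Definition fockX (x : fock_var) : fock := mkmalgU (ucm x) 1.

Definition fock_deriv (x : fock_var) (w : fock) : fock :=
  \sum_(u <- msupp w) mkmalgU (divcm u (ucm x)) (mcoeff u w *+ u x).

(* heis a n is the action of a(n/k) on S[nu], for a in h_(n): a(-n/k) multiplies
   by a(-n/k), and a(n/k) is the derivation that sends b(-n/k) to (n/k) <a, b>.
   The zero modes act by 0 on S[nu]. *)
Definition heis (a : h) (n : int) (w : fock) : fock :=
  match n with
  | Posz 0 => 0
  | Posz n'.+1 => \sum_j
      ((n'.+1%:R / k%:R) * hform a (row j (row_base (hspace (- n'.+1%:Z))))) *:
        fock_deriv (fvar j) w
  | Negz n' => \sum_j
      (a *m pinvmx (row_base (hspace (- n'.+1%:Z)))) 0 j *: (fockX (fvar j) * w)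
  end.

(* The exponent of E^{+-}(-a, x) is the sum, over the integers n of the given
   sign, of Eterm a n x^(-n/k). *)
Definition Eterm (a : lattice X) (n : int) (w : fock) : fock :=
  - (n%:~R / k%:R)^-1 *: heis (hproj n (toh a)) n w.

(* Coefficient of x^(p/k) in E^-(-a, x). *)
Definition Eminus (a : lattice X) (p : nat) : fock -> fock :=
  exp_coef (fun n => Eterm a (- n%:Z)) p.

(* Coefficient of x^(-p/k) in E^+(-a, x). *)
Definition Eplus (a : lattice X) (p : nat) : fock -> fock :=
  exp_coef (fun n => Eterm a n%:Z) p.

(* The induced module U_T is realised as the space of the functions f on hatLnu
   with f (a n) = tau(n)^-1 f a for n in hatN, supported on finitely many cosets
   of hatN: hatLnu acts by left translation, and 1 (x) 1 is the function
   supported on hatN with value tau(n)^-1 at n.  Accordingly V_L^T is the space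
   of such functions with values in S[nu]; it contains vacuum below, and is
   stable under the operators below, which are written on all functions. *)
Local Notation VLT := (hatLnu X -> fock).

Variable tau : hatLnu X -> C.

Definition vacuum : VLT :=
  fun a => if a \in hatN then (tau a)^-1 *: 1 else 0.

Definition translate (a : hatLnu X) (f : VLT) : VLT := fun b => f (a^-1 * b)%g.

(* Coefficient of x^e in the operator x^a, for a in h_(0). *)
Definition xpow (a : h) (e : C) (f : VLT) : VLT :=
  fun b => if hform a (toh (bar b)) == e then f b else 0.

Definition sigma (a : lattice X) : C :=
  (\prod_(1 <= j < nu_order X)
     (1 - eta ^- j) ^ latform (pact (nu X ^+ j)%g a) a)
  * 2 ^ (latform (pact (nu X ^+ nu_order X)%g a) a %/ 2)%Z.

(* The operator (e^a)_(m/k), i.e. the coefficient of x^(- m/k - <a, a>/2) in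
   Y(e^a, x).  A pair pq collects the terms x^(pq.1/k) of E^-(-a, x) and
   x^(-pq.2/k) of E^+(-a, x); expo pq is the exponent that is left for x^(a_(0)).
   At each b only finitely many terms of the sum are nonzero. *)
Definition mode (a : lattice X) (m : int) (f : VLT) : VLT :=
  let a0 := hproj 0 (toh a) in
  let n := (latform a a)%:~R / 2 : C in
  let expo (pq : nat * nat) : C :=
    - (m%:~R / k%:R) - n
    - (pq.1%:R / k%:R - pq.2%:R / k%:R + hform a0 a0 / 2 - n) in
  fun b => (k%:R ^ (- (latform a a %/ 2)%Z) * sigma a) *:
    \sum_(pq \in [set: nat * nat])
      Eminus a pq.1 (Eplus a pq.2 (translate (sect a) (xpow a0 (expo pq) f) b)).

(* [:: (i_1, m_1); ...; (i_s, m_s)] stands for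
   (e^(alpha_(i_1)))_(m_1/k) ... (e^(alpha_(i_s)))_(m_s/k) 1_T. *)
Definition monomial (s : seq ('I_(rk X) * int)) : VLT :=
  foldr (fun im => mode (simple im.1) im.2) vacuum s.

Definition WLT : set VLT := lin_span (range monomial).

Definition charge (s : seq ('I_(rk X) * int)) (r : 'I_(ncyc X)) : nat :=
  count (fun im => im.1 \in porbit (nu X) (lead r)) s.

Definition wt_vacuum : rat :=
  (4 * k%:R ^+ 2)^-1 *
  \sum_(1 <= j < k) (j * (k - j) * \rank (hspace j%:Z))%:R.

Definition wt (s : seq ('I_(rk X) * int)) : rat :=
  - (\sum_(im <- s) im.2%:~R / k%:R) + wt_vacuum.

(* (W_L^T)_(m, n): W_L^T is graded by giving each monomial its charge and its
   weight, so that a homogeneous component is the span of the monomials of that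
   charge and weight. *)
Definition WLT_component (m : 'I_(ncyc X) -> nat) (n : nat) : set VLT :=
  lin_span (monomial @`
    [set s | charge s =1 m /\ k%:R * (wt s - wt_vacuum) = n%:R]).

(* Coefficient of x^m q^n in chi'. *)
Definition chi' (m : 'I_(ncyc X) -> nat) (n : nat) : nat :=
  dim (WLT_component m n).

Definition Amx : 'M[C]_(ncyc X) :=
  \matrix_(i, j) (k%:R * hform (hproj 0 (toh (simple (lead i))))
                               (hproj 0 (toh (simple (lead j))))).

End Twisted.

Arguments Nlat {R} X eta.
Arguments Mlat X : clear implicits.
Arguments Rlat {R} X eta.
Arguments hatN {R X} eta.
Arguments vacuum {R X} eta tau.
Arguments mode {R X} eta a m f.
Arguments monomial {R X} eta tau s.
Arguments WLT {R X} eta tau.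
Arguments WLT_component {R X} eta tau m n.
Arguments chi' {R X} eta tau m n.

Definition qpoch (A : pzRingType) (a q : A) (n : nat) : A :=
  \prod_(i < n) (1 - a * q ^+ i).

(* Coefficient of q^n in the power series u / p, for p with constant term 1. *)
Definition qfrac (A : nzRingType) (u p : {poly A}) (n : nat) : A :=
  (u * \sum_(i < n.+1) (1 - p) ^+ i)`_n.

Lemma qfracP (A : comNzRingType) (u p : {poly A}) (n : nat) : p`_0 = 1 ->
  \sum_(i < n.+1) p`_i * qfrac u p (n - i) = u`_n.
Proof.
move=> p0; have [r Er] : exists r, 1 - p = r * 'X.
  exists (drop_poly 1 (1 - p)); rewrite -[LHS](poly_take_drop 1) expr1.
  by rewrite [take_poly _ _]size1_polyC ?size_take_poly// coef_take_poly coefB coefC p0 subrr add0r.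
have lowX (q : {poly A}) i m : (m < i)%N -> (q * (1 - p) ^+ i)`_m = 0.
  by move=> mi; rewrite Er exprMn mulrA coefMXn mi.
have stab m : (m <= n)%N ->
    qfrac u p m = (u * \sum_(i < n.+1) (1 - p) ^+ i)`_m.
  move=> mn; rewrite /qfrac -(subnKC mn) -addSn big_split_ord /= mulrDr coefD.
  rewrite [X in _ = _ + X](_ : _ = 0) ?addr0//.
  rewrite mulr_sumr coef_sum big1 // => i _; apply: lowX.
  by rewrite addSn ltnS leq_addr.
have -> : u`_n = (p * (u * \sum_(i < n.+1) (1 - p) ^+ i))`_n.
  have E : p * \sum_(i < n.+1) (1 - p) ^+ i = 1 - (1 - p) ^+ n.+1.
    have := subrX1 (1 - p) n.+1.
    have -> : 1 - p - 1 = - p by rewrite addrAC subrr add0r.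
    by rewrite mulNr => H; rewrite -[RHS]opprB H opprK.
  by rewrite mulrCA E mulrBr mulr1 coefB lowX ?subr0.
rewrite coefM; apply: eq_bigr => i _; rewrite stab// leq_subr //.
Qed.

(* Main.v *)
(* On a vector of charge m the operators Y(e^(alpha_i), x) act, up to a nonzero
   scalar and a fixed power of x, on S[nu] alone, as E^-(-alpha_i, x) E^+(-alpha_i, x).
   Write H_(i, p) for the coefficient of x^(p/k) in E^-(-alpha_i, x) 1.  The
   coefficients of E^+ are polynomials in derivations which send H_(j, p) to
   multiples of the H_(j, p - n), and the constant term of E^+ is 1.  Hence, by
   induction on the number of factors and on the degree, the monomials of charge m
   span the same space as the products of H's with the same charge, in a degree
   that is shifted by e(m) = k <a_(0), a_(0)>/2, a = \sum_r m_r alpha^(r).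
   Since H_(nu i, p) = eta^-p H_(i, p), only the H_(r, p) with k/l_r dividing p and
   alpha^(r) a cycle leader remain.  These are the complete symmetric functions in
   algebraically independent power sums (the coordinates of h_(-n) at the leaders
   separate the cycles), so they are algebraically independent themselves, and the
   component of charge m has a basis indexed by the tuples of partitions with at
   most m_r parts. *)

Require Import Defs.
From HB Require Import structures.
From mathcomp Require Import all_boot all_order all_fingroup all_algebra.
From mathcomp Require Import boolp classical_sets functions cardinality fsbigop.
From mathcomp Require Import finmap reals complex monalg.
From mathcomp Require Import ring zify.

Set Implicit Arguments.
Unset Strict Implicit.
Unset Printing Implicit Defensive.

Import Order.TTheory GRing.Theory Num.Theory.
Local Open Scope classical_set_scope.
Local Open Scope ring_scope.

(** * Spans and dimensions *)

Section LinearSpan.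

Variables (K : fieldType) (V : lmodType K).
Implicit Types (A B : set V).

(** Every fact about exponentials comes from one recursion: y = exp f satisfies p y_p = \sum_(0 < n
    <= p) n f_n y_(p-n), which in characteristic 0 determines y from y_0 = 1. It handles
    derivations, rescalings and homomorphic images of exponentials alike. Read backwards, it also
    gives algebraic independence without inverting anything in S[nu]: require that the H_(r, p) with
    p > 0 divisible by k/l_r go to distinct variables of a polynomial algebra; the recursion then
    dictates the images of the power sums, and the coordinates at the cycle leaders define a
    homomorphism with these values. The shift e(m) has to be a natural number although <a_(0),
    a_(0)> is only rational. Since k = 2v and nu^v = 1, it equals \sum_(j < v) <nu^j a, a>, and the
    Gram entries are nonnegative. Partitions are recorded by the numbers of their columns of each
    height, because the columns of height i + 1 are what the factor 1/(1 - q^((i+1)k/l_r)) of the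
    formula counts. *)

Definition subspace B := B 0 /\ forall c u v, B u -> B v -> B (c *: u + v).

Lemma subspaceZ B c u : subspace B -> B u -> B (c *: u).
Proof. by case=> B0 BD Bu; rewrite -[_ *: _]addr0; apply: BD. Qed.

Lemma subspaceD B u v : subspace B -> B u -> B v -> B (u + v).
Proof. by case=> B0 BD Bu Bv; rewrite -[u]scale1r; apply: BD. Qed.

Lemma subspaceB B u v : subspace B -> B u -> B v -> B (u - v).
Proof.
by move=> sB Bu Bv; apply: subspaceD => //; rewrite -scaleN1r; apply: subspaceZ.
Qed.

Lemma subspaceZ_inv B c u : subspace B -> c != 0 -> B (c *: u) -> B u.
Proof.
by move=> sB c0 Bu; rewrite -[u]scale1r -(mulVf c0) -scalerA; apply: subspaceZ.
Qed.

Lemma subspace_sum B (I : Type) (r : seq I) (P : pred I) (F : I -> V) :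
  subspace B -> (forall i, P i -> B (F i)) -> B (\sum_(i <- r | P i) F i).
Proof.
move=> sB BF; apply: (big_ind B) => // [|u v]; first by case: sB.
exact: subspaceD.
Qed.

Lemma sub_lin_span A : A `<=` lin_span A.
Proof.
move=> u Au; exists 1%N, (fun=> 1), (fun=> u); split=> //.
by rewrite big_ord1 scale1r.
Qed.

Lemma lin_span_subspace A : subspace (lin_span A).
Proof.
split=> [|a u v [n [c [x [Ax ->]]]] [n' [c' [x' [Ax' ->]]]]].
  by exists 0%N, (fun=> 0), (fun=> 0); split=> [[]|] //; rewrite big_ord0.
exists (n + n')%N, (fun i : 'I_(n + n') =>
    match fintype.split i with inl j => a * c j | inr j => c' j end),
  (fun i : 'I_(n + n') => match fintype.split i with inl j => x j | inr j => x' j end); split.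
  by move=> i; case: (fintype.split i).
rewrite big_split_ord /= scaler_sumr; congr (_ + _); apply: eq_bigr => i _.
  by rewrite (unsplitK (inl i)) scalerA.
by rewrite (unsplitK (inr i)).
Qed.

Lemma lin_span_min A B : subspace B -> A `<=` B -> lin_span A `<=` B.
Proof.
move=> sB AB u [n [c [x [Ax ->]]]]; apply: subspace_sum => // i _.
by apply: subspaceZ => //; apply: AB.
Qed.

(** The coefficients of [b] in terms of [b'] form an n x n' matrix. A row vector killed by it gives
    a relation among the [b i], so the matrix has full row rank n, and the rank is at most n'. *)
Lemma has_dim_le n n' (b : 'I_n -> V) (b' : 'I_n' -> V) :
  range b `<=` lin_span (range b') ->
  (forall c : 'I_n -> K, \sum_(i < n) c i *: b i = 0 -> forall i, c i = 0) ->
  (n <= n')%N.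
Proof.
move=> bb' free_b.
have /choice[M bM] : forall i, exists m : 'rV[K]_n', b i = \sum_j m 0 j *: b' j.
  move=> i; have: lin_span (range b') (b i) by apply: bb'; exists i.
  apply: (@lin_span_min _ [set u | exists m : 'rV_n', u = \sum_j m 0 j *: b' j]).
    split=> [|c _ _ [m ->] [m' ->]].
      by exists 0; rewrite big1 // => j _; rewrite mxE scale0r.
    exists (c *: m + m'); rewrite scaler_sumr -big_split; apply: eq_bigr => j _.
    by rewrite !mxE scalerDl scalerA.
  move=> _ [j _ <-]; exists (delta_mx 0 j); rewrite (bigD1 j) //= mxE !eqxx scale1r.
  by rewrite big1 ?addr0 // => l lj; rewrite mxE (negPf lj) scale0r.
pose N := \matrix_i M i.
suff /eqP <- : row_free N by apply: rank_leq_col.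
rewrite -kermx_eq0; apply/eqP/row_matrixP => i; rewrite row0.
set v := row i _; have vN : v *m N = 0.
  by apply: sub_kermxP; apply: row_sub.
apply/rowP => j; rewrite [RHS]mxE; apply: (free_b (fun j => v 0 j)).
under eq_bigr do rewrite bM scaler_sumr.
rewrite exchange_big big1 //= => l _; under eq_bigr do rewrite scalerA.
rewrite -scaler_suml; suff -> : \sum_i0 v 0 i0 * M i0 0 l = (v *m N) 0 l by rewrite vN mxE scale0r.
by rewrite mxE; apply: eq_bigr => p _; rewrite [N _ _]mxE.
Qed.

Lemma has_dim_uniq A n n' : has_dim A n -> has_dim A n' -> n = n'.
Proof.
move=> [b [bA fb]] [b' [b'A fb']]; apply/eqP; rewrite eqn_leq; apply/andP; split.
  by apply: (@has_dim_le n n' b b') => //; rewrite b'A -bA; apply: sub_lin_span.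
by apply: (@has_dim_le n' n b' b) => //; rewrite bA -b'A; apply: sub_lin_span.
Qed.

Lemma has_dimE A n : has_dim A n -> Defs.dim A = n.
Proof.
move=> An; rewrite /Defs.dim; case: xgetP => [n' _ An'|/(_ n)//].
exact: has_dim_uniq An' An.
Qed.

End LinearSpan.

Lemma linear_fun0 (K : pzRingType) (U V : lmodType K) (f : U -> V) : linear f -> f 0 = 0.
Proof. by move=> /(_ (-1) 0 0); rewrite scaler0 addr0 scaleN1r addNr. Qed.

Lemma linear_funZ (K : pzRingType) (U V : lmodType K) (f : U -> V) c u :
  linear f -> f (c *: u) = c *: f u.
Proof. by move=> flin; rewrite -[_ *: u]addr0 flin (linear_fun0 flin) addr0. Qed.

Lemma subspace_preimage (K : fieldType) (U V : lmodType K) (f : U -> V) (B : set V) :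
  linear f -> subspace B -> subspace [set u | B (f u)].
Proof.
move=> flin [B0 BD]; split=> [|c u v Bu Bv] /=; first by rewrite linear_fun0.
by rewrite flin; apply: BD.
Qed.

Lemma lin_span_image (K : fieldType) (V W : lmodType K) (f : V -> W) (A : set V) :
  linear f -> lin_span (f @` A) = f @` lin_span A.
Proof.
move=> flin; pose F : {linear V -> W} := HB.pack f (GRing.isLinear.Build _ _ _ _ _ flin).
apply/seteqP; split.
  apply: lin_span_min => [|_ [u Au <-]]; last by exists u => //; apply: sub_lin_span.
  have [s0 sD] := lin_span_subspace A; split.
    by exists 0 => //; apply: (linear0 F).
  move=> c _ _ [u Au <-] [v Av <-]; exists (c *: u + v); [exact: sD|exact: (linearP F)].
move=> _ [_ [n [c [x [Ax ->]]]] <-]; exists n, c, (f \o x); split.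
  by move=> i; exists (x i).
rewrite -[f]/(F : V -> W) linear_sum; apply: eq_bigr => i _; exact: linearZ.
Qed.

Lemma has_dim_image (K : fieldType) (V W : lmodType K) (f : V -> W) (A : set V) n :
  linear f -> (forall u, f u = 0 -> u = 0) -> has_dim A n -> has_dim (f @` A) n.
Proof.
move=> flin finj [b [bA fb]]; exists (f \o b); split.
  by rewrite -bA -lin_span_image // image_comp.
pose F : {linear V -> W} := HB.pack f (GRing.isLinear.Build _ _ _ _ _ flin).
move=> c E; apply: fb; apply: finj; rewrite -[f]/(F : V -> W) linear_sum -[RHS]E.
by apply: eq_bigr => i _; rewrite linearZ.
Qed.

(** * Exponentials of power series *)

Section ExpMul.

Variables (K : numFieldType) (S : comAlgType K) (a : nat -> S).

Let mul_a := fun n w => a n * w.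

(** Truncating the exponent at degree N turns [pow_coef] into the coefficient of an ordinary
    polynomial power; the constant term is dropped because [pow_coef] sums from n = 1. *)
Let gen (N : nat) : {poly S} := \poly_(i < N.+1) (if i == 0%N then 0 else a i).

Lemma pow_coef_mulE N j p w : (p <= N)%N ->
  pow_coef mul_a j p w = (gen N ^+ j)`_p * w.
Proof.
elim: j p => [|j IH] p pN /=.
  by rewrite expr0 coef1; case: eqP; rewrite ?mul1r ?mul0r.
rewrite exprS coefM mulr_suml big_ord_recl coef_poly /= !mul0r add0r.
rewrite big_add1 big_mkord; apply: eq_bigr => i _.
rewrite /bump add1n coef_poly ltnS (leq_trans (ltn_ord i) pN) /= -mulrA.
by rewrite /mul_a IH // (leq_trans (leq_subr _ _) pN).
Qed.

Lemma exp_coef_mulE p w : exp_coef mul_a p w = exp_coef mul_a p 1 * w.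
Proof.
rewrite /exp_coef mulr_suml; apply: eq_bigr => j _.
by rewrite !(pow_coef_mulE _ _ (leqnn p)) mulr1 scalerAl.
Qed.

(* With f = sum_n a_n z^n, this is the coefficient of z^p in
   z (exp f)' = z f' exp f. *)
Lemma exp_coef_mul_newton p :
  p%:R * exp_coef mul_a p 1 =
  \sum_(1 <= n < p.+1) n%:R * a n * exp_coef mul_a (p - n) 1.
Proof.
case: p => [|p]; first by rewrite mul0r big_geq.
have low j q : (q < j)%N -> (gen p.+1 ^+ j)`_q = 0.
  move=> qj; rewrite (_ : gen p.+1 = drop_poly 1 (gen p.+1) * 'X).
    by rewrite exprMn coefMXn qj.
  rewrite -[LHS](poly_take_drop 1) expr1 [take_poly _ _](_ : _ = 0) ?add0r //.
  by apply/polyP => -[|i]; rewrite coef_take_poly coef0 // coef_poly.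
(* The exponential series cut at order M. By [low] its terms of order j start in degree j, so it is
   exact up to degree M. *)
pose ef M := \sum_(j < M.+1) ((j`!%:R : K)^-1)%:A *: gen p.+1 ^+ j.
have efE M q : (q <= M)%N -> (q <= p.+1)%N -> exp_coef mul_a q 1 = (ef M)`_q.
  move=> qM qp; rewrite /ef coef_sum /exp_coef (big_ord_widen M.+1 (fun j =>
    (j`!%:R)^-1 *: pow_coef mul_a j q 1)) //.
  rewrite [RHS](bigID (fun j : 'I_M.+1 => (j < q.+1)%N)) /= [X in _ + X]big1 ?addr0.
    by apply: eq_bigr => j _; rewrite (pow_coef_mulE _ _ qp) mulr1 coefZ mulr_algl.
  by move=> j; rewrite -leqNgt => qj; rewrite coefZ low ?mulr0.
(* Differentiation lowers the order from p + 1 to p, which is still exact in the degree p that is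
   compared. *)
have ef' : (ef p.+1)^`() = (gen p.+1)^`() * ef p.
  rewrite /ef big_ord_recl derivD expr0 derivZ derivC scaler0 add0r.
  rewrite raddf_sum mulr_sumr; apply: eq_bigr => j _ /=; rewrite derivZ.
  rewrite /bump add1n deriv_exp /= -scaler_nat -scalerAr !scalerA; congr (_ *: _).
  rewrite mulr_algl -scaler_nat scalerA.
  rewrite factS natrM invfM mulrAC mulVf ?mul1r //.
  by rewrite pnatr_eq0.
have /(congr1 (fun f : {poly S} => f`_p)) := ef'.
rewrite coef_deriv -(efE p.+1 p.+1) // mulr_natl => ->.
rewrite coefM big_add1 big_mkord; apply: eq_bigr => i _.
rewrite coef_deriv coef_poly ltnS ltn_ord /= mulr_natl subSS.
by rewrite -(efE p (p - i)%N) ?leq_subr // leqW // leq_subr.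
Qed.

End ExpMul.

(** The term n = p of the sum is [g p * y 0 = g p], so the equation can be solved for it: [g] is the
    coefficient sequence of z y' / y. *)
Lemma newton_inverse (S : pzRingType) (y : nat -> S) : y 0%N = 1 ->
  exists g : nat -> S, forall p,
    p%:R * y p = \sum_(1 <= n < p.+1) g n * y (p - n)%N.
Proof.
move=> y0.
pose next (s : seq S) := (size s)%:R * y (size s)
  - \sum_(1 <= n < size s) s`_n * y (size s - n)%N.
(* Course-of-values recursion: [gs n] lists the first n values of [g], and [next] solves the
   equation for the following one. *)
pose gs := fix gs n := if n is n'.+1 then rcons (gs n') (next (gs n')) else [::].
have size_gs n : size (gs n) = n by elim: n => //= n IH; rewrite size_rcons IH.
exists (fun n => (gs n.+1)`_n) => p.
have gsS n : gs n.+1 = rcons (gs n) (next (gs n)) by [].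
clearbody gs.
have gsE m n : (n < m)%N -> (gs m)`_n = (gs n.+1)`_n.
  elim: m => // m IH; rewrite ltnS leq_eqVlt => /predU1P[->//|nm].
  by rewrite gsS nth_rcons size_gs nm IH.
case: p => [|p]; first by rewrite mul0r big_geq.
rewrite big_nat_recr //= subnn y0 mulr1 gsS nth_rcons size_gs ltnn eqxx.
rewrite /next size_gs addrC.
rewrite (_ : \sum_(1 <= n < p.+1) (gs p.+1)`_n * _ =
             \sum_(1 <= n < p.+1) (gs n.+1)`_n * y (p.+1 - n)%N) ?subrK //.
by apply: eq_big_nat => n /andP[_ np]; rewrite gsE.
Qed.

(* On both sides, the coefficients up to degree n only depend on the classes
   modulo 'X^(n.+1), where the product of the truncated geometric series is
   inverse to the denominator. *)
Lemma qfrac_prod_geometric (J : finType) (w : J -> nat) (e n : nat) :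
    (forall j, 0 < w j)%N ->
  qfrac 'X^e (\prod_j (1 - 'X^(w j))) n =
  (if (e <= n)%N then
     #|[pred c : {ffun J -> 'I_n.+1} | (\sum_j w j * c j == n - e)%N]| else 0%N)%:Z.
Proof.
move=> w_gt0; set p : {poly int} := \prod_j _.
pose S : {poly int} := \prod_j \sum_(i < n.+1) 'X^(w j * i).
pose T : {poly int} := \sum_(i < n.+1) (1 - p) ^+ i.
pose eqmod (a b : {poly int}) := exists r, a - b = r * 'X^(n.+1).
have pS : eqmod (p * S) 1.
  rewrite /p /S -big_split /=.
  apply: (big_rec (fun x => eqmod x 1)); first by exists 0; rewrite subrr mul0r.
  (* The geometric sum telescopes to 1 - 'X^(w j * n.+1), and [w j > 0] lets 'X^(n.+1) be split
     off. *)
  move=> j x _ [r Er]; exists (r * (1 - 'X^(w j * n.+1)) - 'X^((w j).-1 * n.+1)).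
  have -> : (1 - 'X^(w j)) * \sum_(i < n.+1) 'X^(w j * i) = 1 - 'X^(w j * n.+1) :> {poly int}.
    under eq_bigr do rewrite exprM; have := subrX1 ('X^(w j) : {poly int}) n.+1.
    by rewrite -exprM => E; rewrite -opprB mulNr -E opprB.
  have -> : 'X^(w j * n.+1) = 'X^((w j).-1 * n.+1) * 'X^(n.+1) :> {poly int}.
    by rewrite -exprD addnC -mulSn prednK.
  have -> : x = r * 'X^(n.+1) + 1 by rewrite -Er subrK.
  ring.
have pT : eqmod (p * T) 1.
  have [r Er] : exists r, 1 - p = r * 'X.
    exists (drop_poly 1 (1 - p)); rewrite -[LHS](poly_take_drop 1) expr1.
    rewrite [take_poly _ _]size1_polyC ?size_take_poly // coef_take_poly /=.
    rewrite coefB coef1 /= /p coef0_prod big1 ?subrr ?add0r // => j _.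
    by rewrite coefB coef1 coefXn [0%N == w j]ltn_eqF ?w_gt0.
  exists (- r ^+ n.+1); have := subrX1 (1 - p) n.+1; rewrite -/T.
  have -> : 1 - p - 1 = - p by rewrite addrAC subrr add0r.
  rewrite mulNr => E; rewrite mulNr -exprMn -Er -[p * T]opprK -E; ring.
(* Two inverses of [p] modulo 'X^(n.+1) agree: S - T = T (p S - 1) - S (p T - 1). *)
have [r ST] : eqmod S T.
  have [r1 E1] := pS; have [r2 E2] := pT; exists (S * - r2 + T * r1).
  rewrite mulrDl -!mulrA mulNr -E1 -E2; ring.
rewrite /qfrac -/T; have -> : T = S - r * 'X^(n.+1) by rewrite -ST; ring.
rewrite mulrBr coefB [X in _ - X](_ : _ = 0) ?subr0; last by rewrite mulrA coefMXn ltnSn.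
rewrite coefXnM; case: ltnP => //= en.
rewrite /S bigA_distr_bigA coef_sum /=.
rewrite (eq_bigr (fun f : {ffun J -> 'I_n.+1} =>
  ((\sum_j w j * f j)%N == (n - e)%N)%:R)); last first.
  by move=> f _; rewrite -expr_sum coefXn eq_sym.
rewrite -natr_sum -sum1_card [in RHS]big_mkcond /= natz; congr Posz.
Qed.

Section IntegerExp.

Variables (K : numFieldType) (S : comAlgType K).
Implicit Types (a : nat -> S) (w : S).

(* Integer exponents, with value 0 below 0, keep the degree count free of
   truncated subtractions. *)
Definition expz a (p : int) : S :=
  if p is Posz p' then exp_coef (fun n w => a n * w) p' 1 else 0.

Lemma expz_neg a (p : int) : p < 0 -> expz a p = 0.
Proof. by case: p. Qed.

Lemma expz0 a : expz a 0 = 1.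
Proof. by rewrite /expz /= /exp_coef big_ord1 /= invr1 scale1r. Qed.

(** The terms with n > p vanish, so any N >= p serves as upper bound. This allows recursions at
    different degrees to be compared over one range. *)
Lemma expz_newton a (p : int) N : p <= N%:Z ->
  p%:~R *: expz a p = \sum_(1 <= n < N.+1) n%:R *: (a n * expz a (p - n%:Z)).
Proof.
case: p => [p pN|p _]; last first.
  rewrite /= scaler0 big1 // => n _.
  by rewrite [expz a _]expz_neg ?mulr0 ?scaler0 //; lia.
have {}pN : (p <= N)%N by lia.
rewrite (big_cat_nat (n := p.+1)) //= [X in _ + X]big1_seq ?addr0; last first.
  move=> n /andP[_]; rewrite mem_index_iota => /andP[pn _].
  by rewrite [expz a _]expz_neg ?mulr0 ?scaler0 //; lia.
rewrite -pmulrn scaler_nat -mulr_natl exp_coef_mul_newton.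
apply: eq_big_nat => n /andP[_ np]; rewrite subzn // -mulrA mulr_natl.
by rewrite -scaler_nat.
Qed.

Lemma expz_uniq a (y : nat -> S) : y 0%N = 1 ->
  (forall p, p%:R *: y p = \sum_(1 <= n < p.+1) n%:R *: (a n * y (p - n)%N)) ->
  forall p : nat, expz a p%:Z = y p.
Proof.
move=> y0 yE p; elim/ltn_ind: p => -[_|p IH]; first by rewrite y0 expz0.
have p0 : (p.+1%:R : K) != 0 by rewrite pnatr_eq0.
apply: (scalerI p0); rewrite yE pmulrn (@expz_newton _ _ p.+1) //.
apply: eq_big_nat => n /andP[n0 np]; rewrite subzn // IH //.
by rewrite ltn_subrL n0.
Qed.

End IntegerExp.

Section Derivation.

Variables (K : numFieldType) (S : comAlgType K) (D : {linear S -> S}).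
Hypothesis DM : forall u v, D (u * v) = D u * v + u * D v.

Lemma derivation1 : D 1 = 0.
Proof. by apply: (@addrI _ (D 1)); rewrite addr0 -[RHS](congr1 D (mulr1 1)) DM mulr1 mul1r. Qed.

(** Formally D (exp f) = (D f) exp f, and here D f = c z^n. *)
Lemma derivation_expz (a : nat -> S) (n : nat) (c : K) : (0 < n)%N ->
    (forall m, D (a m) = if m == n then c%:A else 0) ->
  forall p, D (expz a p) = c *: expz a (p - n%:Z).
Proof.
move=> n0 Da [p|p]; last by rewrite linear0 [expz a (_ - _)]expz_neg ?scaler0 //; lia.
elim/ltn_ind: p => -[_|p IH].
  by rewrite expz0 derivation1 [expz a _]expz_neg ?scaler0 //; lia.
have p0 : (p.+1%:R : K) != 0 by rewrite pnatr_eq0.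
apply: (scalerI p0); rewrite -linearZ /= [in LHS]pmulrn (@expz_newton _ _ _ _ p.+1) //.
rewrite linear_sum (eq_big_nat _ _ (F2 := fun m =>
  (if m == n then n%:R *: (c *: expz a (p.+1%:Z - n%:Z)) else 0)
  + c *: (m%:R *: (a m * expz a (p.+1%:Z - n%:Z - m%:Z))))); last first.
  move=> m /andP[m0 mp]; rewrite linearZ /= DM subzn // IH; last by lia.
  rewrite scalerDr Da; congr (_ + _).
    case: eqP => [<-|_]; last by rewrite mul0r scaler0.
    by rewrite -scalerAl mul1r subzn // ltnW.
  rewrite -scalerAr !scalerA mulrC; congr (_ *: (_ * expz a _)); lia.
(* The second sum is the recursion in degree p + 1 - n. It contributes the factor p + 1 - n, the
   term m = n contributes n, and together they give p + 1. *)
rewrite big_split -scaler_sumr -expz_newton /=; last by lia.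
rewrite -big_mkcond /= big_nat1_eq n0 /= ltnS.
have -> : (if (n <= p.+1)%N then n%:R *: (c *: expz a (p.+1%:Z - n%:Z)) else 0) =
    n%:R *: (c *: expz a (p.+1%:Z - n%:Z)).
  by case: leqP => // np; rewrite expz_neg ?scaler0 //; lia.
rewrite !scalerA -scalerDl; congr (_ *: _).
rewrite rmorphB /= -!pmulrn; ring.
Qed.

End Derivation.

(** * Homogeneous products of exponential coefficients *)

Section HomogeneousProducts.

Variables (K : numFieldType) (S : comAlgType K) (I : eqType) (a : I -> nat -> S).
Implicit Types (s : seq I) (t : seq (I * int)) (N : int) (w : S).

Definition prodz t : S := \prod_(x <- t) expz (a x.1) x.2.

Definition homog s N : set S :=
  lin_span (prodz @` [set t | map fst t = s /\ \sum_(x <- t) x.2 = N]).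

Lemma homog_subspace s N : subspace (homog s N).
Proof. exact: lin_span_subspace. Qed.

Lemma homog_prodz t : homog (map fst t) (\sum_(x <- t) x.2) (prodz t).
Proof. by apply: sub_lin_span; exists t. Qed.

Lemma homogMl i p s N w : homog s N w -> homog (i :: s) (p + N) (expz (a i) p * w).
Proof.
apply: (@lin_span_min _ _ _ [set w | homog (i :: s) (p + N) (expz (a i) p * w)]).
  have [H0 HD] := homog_subspace (i :: s) (p + N).
  split=> [|c u v Hu Hv] /=; first by rewrite mulr0.
  by rewrite mulrDr -scalerAr; apply: HD.
move=> _ [t [<- <-] <-] /=; apply: sub_lin_span; exists ((i, p) :: t).
  by rewrite /= big_cons.
by rewrite /prodz big_cons.
Qed.

Lemma prodz_neg t x : x \in t -> x.2 < 0 -> prodz t = 0.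
Proof. by move=> xt x0; rewrite /prodz (big_rem x) //= expz_neg // mul0r. Qed.

Lemma homog_neg s N w : N < 0 -> homog s N w -> w = 0.
Proof.
move=> N0; apply: (@lin_span_min _ _ _ [set 0]) => [|_ [t [_ tN] <-]].
  by split=> // c _ _ -> ->; rewrite scaler0 addr0.
have [/hasP[x xt x0]|nt] := boolP (has (fun x => x.2 < 0) t).
  exact: prodz_neg xt x0.
move: N0; rewrite -tN ltNge big_seq sumr_ge0 // => x xt.
by rewrite leNgt; apply/negP => x0; case/hasP: nt; exists x.
Qed.

Lemma homog_derivation (D : {linear S -> S}) (n : nat) (c : I -> K) :
    (forall u v, D (u * v) = D u * v + u * D v) -> (0 < n)%N ->
    (forall i m, D (a i m) = if m == n then (c i)%:A else 0) ->
  forall s N w, homog s N w -> homog s (N - n%:Z) (D w).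
Proof.
move=> DM n0 Da s N; apply: (@lin_span_min _ _ _ [set w | homog s (N - n%:Z) (D w)]).
  have [H0 HD] := homog_subspace s (N - n%:Z).
  split=> [|b u v Hu Hv] /=; first by rewrite linear0.
  by rewrite linearP; apply: HD.
move=> _ [t [<- <-] <-] /= {s N}; elim: t => [|[i p] t IH].
  by rewrite /prodz !big_nil (derivation1 DM); case: (homog_subspace [::] (0 - n%:Z)).
rewrite /prodz !big_cons DM (derivation_expz DM n0 (Da i)) /=.
apply: subspaceD; first exact: homog_subspace.
  rewrite -scalerAl; apply: subspaceZ; first exact: homog_subspace.
  by rewrite addrAC; apply/homogMl/homog_prodz.
by rewrite -addrA; apply: homogMl.
Qed.

Lemma homog_exp_coef (A : nat -> S -> S) s N w :
    (forall n s N w, (0 < n)%N -> homog s N w -> homog s (N - n%:Z) (A n w)) ->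
    homog s N w ->
  forall q, homog s (N - q%:Z) (exp_coef A q w).
Proof.
move=> HA Hw q; have [H0 _] := homog_subspace s (N - q%:Z).
apply: subspace_sum => [|j _]; first exact: homog_subspace.
apply: subspaceZ; first exact: homog_subspace.
move: (nat_of_ord j) => {}j; elim: j q H0 => [|j IH] q H0 /=; first by case: eqP => // ->; rewrite subr0.
rewrite big_nat; apply: subspace_sum => [|n /andP[n0 nq]]; first exact: homog_subspace.
rewrite (_ : N - q%:Z = N - (q - n)%N%:Z - n%:Z); last by lia.
by apply: HA => //; apply: IH; case: (homog_subspace s (N - (q - n)%N%:Z)).
Qed.

End HomogeneousProducts.

Lemma exp_coef0 (K : numFieldType) (V : lmodType K) (A : nat -> V -> V) w :
  exp_coef A 0 w = w.
Proof. by rewrite /exp_coef big_ord1 /= invr1 scale1r. Qed.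

(** * Products of vertex operators *)

Lemma exp_coef_linear (K : fieldType) (V : lmodType K) (A : nat -> V -> V) q :
  (forall n, (0 < n)%N -> linear (A n)) -> linear (exp_coef A q).
Proof.
move=> Alin c u v; rewrite /exp_coef scaler_sumr -big_split; apply: eq_bigr => j _ /=.
rewrite scalerA mulrC -scalerA -scalerDr; congr (_ *: _).
move: (nat_of_ord j) => {}j; elim: j q => [|j IH] q /=.
  by case: eqP; rewrite ?scaler0 ?addr0.
rewrite scaler_sumr -big_split big_nat [RHS]big_nat; apply: eq_bigr => n /andP[n0 _].
by rewrite IH Alin.
Qed.

Section VertexOperators.

Variables (K : numFieldType) (S : comAlgType K) (I : eqType) (a : I -> nat -> S).
Variable A : I -> nat -> S -> S.
Hypothesis A_linear : forall i n, (0 < n)%N -> linear (A i n).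
Hypothesis A_homog : forall i n s N w, (0 < n)%N ->
  homog a s N w -> homog a s (N - n%:Z) (A i n w).

(* The coefficient of x^M in E^-(x) E^+(x) w for w of degree N, where
   E^-(x) = exp (\sum_n a i n x^n) and E^+(x) = exp (\sum_n A i n x^-n). *)
Definition vop i (M N : int) (w : S) : S :=
  \sum_(q < `|N|.+1) expz (a i) (M + q%:Z) * exp_coef (A i) q w.

(** By [vops_homog] the vector on which the head operator acts has the sum of the remaining
    exponents as its degree; [vop] needs this degree to cut off E^+. *)
Fixpoint vops (t : seq (I * int)) : S :=
  if t is (i, M) :: t' then vop i M (\sum_(x <- t') x.2) (vops t') else 1.

Lemma vop_linear i M N : linear (vop i M N).
Proof.
move=> c u v; rewrite /vop scaler_sumr -big_split; apply: eq_bigr => q _ /=.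
by rewrite exp_coef_linear ?mulrDr ?scalerAr // => n; apply: A_linear.
Qed.

Lemma vop_homog i M N s w : homog a s N w -> homog a (i :: s) (M + N) (vop i M N w).
Proof.
move=> Hw; apply: subspace_sum => [|q _]; first exact: homog_subspace.
have -> : M + N = (M + q%:Z) + (N - q%:Z) by lia.
by apply: homogMl; apply: homog_exp_coef => //; apply: A_homog.
Qed.

Lemma vops_homog t : homog a (map fst t) (\sum_(x <- t) x.2) (vops t).
Proof.
elim: t => [|[i M] t IH]; last by rewrite big_cons; apply: vop_homog.
by have := homog_prodz a [::]; rewrite /prodz !big_nil.
Qed.

(** Triangularity: E^+ has constant term 1, so [expz (a i) p * w] is [vop i p N' w] minus terms in
    which w is replaced by a vector of smaller degree and p is raised by the same amount. The inner
    induction is on the degree of w. *)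
Lemma lin_span_vops s N :
  lin_span (vops @` [set t | map fst t = s /\ \sum_(x <- t) x.2 = N]) = homog a s N.
Proof.
apply/seteqP; split.
  apply: lin_span_min; first exact: homog_subspace.
  by move=> _ [t [<- <-] <-]; apply: vops_homog.
pose Sp s N := lin_span (vops @` [set t | map fst t = s /\ \sum_(x <- t) x.2 = N]).
rewrite -/(Sp s N).
have sS s' N' : subspace (Sp s' N') by exact: lin_span_subspace.
elim: s N => [|i s IHs] N.
  apply: lin_span_min => [|_ [[|//= x t] [//= _ <-] <-]]; first exact: sS.
  by apply: sub_lin_span; exists [::]; rewrite // /prodz big_nil.
(* The bound n starts the induction at negative degree, where [homog_neg] gives w = 0. *)
suff step n N' p w : N' < n%:Z -> homog a s N' w ->
    Sp (i :: s) (p + N') (expz (a i) p * w).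
  apply: lin_span_min => [|_ [[|[j p] t] [//= [-> ts] <-] <-]]; first exact: sS.
  rewrite /prodz !big_cons; apply: (step `|\sum_(x <- t) x.2|.+1).
    by move: (\sum_(x <- t) x.2) => z; lia.
  by rewrite -ts; apply: homog_prodz.
elim: n N' p w => [|n IHn] N' p w N'n Hw.
  by rewrite (homog_neg N'n Hw) mulr0; case: (sS (i :: s) (p + N')).
have Hop : Sp (i :: s) (p + N') (vop i p N' w).
  move: (IHs _ _ Hw); apply: (@lin_span_min _ _ _ [set w | Sp (i :: s) (p + N') (vop i p N' w)]).
    have [S0 SD] := sS (i :: s) (p + N'); split=> [|c u v Su Sv] /=.
      by rewrite (linear_fun0 (vop_linear i p N')).
    by rewrite vop_linear; apply: SD.
  move=> _ [t [ts tN] <-]; apply: sub_lin_span; exists ((i, p) :: t).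
    by rewrite /= big_cons ts tN.
  by rewrite /= tN.
rewrite (_ : expz _ _ * w = vop i p N' w -
  \sum_(q < `|N'|) expz (a i) (p + q.+1%:Z) * exp_coef (A i) q.+1 w); last first.
  rewrite /vop big_ord_recl /= addr0 exp_coef0 addrK //.
apply: subspaceB => //; apply: subspace_sum => // q _.
have -> : p + N' = (p + q.+1%:Z) + (N' - q.+1%:Z) by lia.
apply: IHn; first by lia.
by apply: homog_exp_coef => // *; apply: A_homog.
Qed.

End VertexOperators.

(** * The lattice *)

Section Cycles.

Variable X : twisted_lattice.

Implicit Types (r s : 'I_(ncyc X)) (i : 'I_(rk X)).

Local Notation l r := (tnth (len X) r).

Lemma cyc_proof i : (reshape_index (len X) i < ncyc X)%N.
Proof. by have := reshape_indexP (ltn_ord i); rewrite size_tuple. Qed.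

Definition cyc i : 'I_(ncyc X) := Ordinal (cyc_proof i).

Lemma nth_len r : nth 0%N (len X) r = l r.
Proof. by rewrite (tnth_nth 0%N). Qed.

Lemma nuX_lead r j : (nu X ^+ j)%g (lead r) = flatten_index (len X) r (j %% l r) :> nat.
Proof.
elim: j => [|j IH]; first by rewrite expg0 perm1 mod0n.
have jl : (j %% l r < nth 0 (len X) r)%N by rewrite nth_len ltn_mod len_gt0.
rewrite expgSr permM nu_cycles IH (flatten_indexKl jl) ?nth_len.
rewrite (flatten_indexKr jl); congr flatten_index.
by rewrite -addn1 modnDml addn1.
Qed.

Lemma cyc_nuX_lead r j : cyc ((nu X ^+ j)%g (lead r)) = r.
Proof.
apply: val_inj; rewrite /= nuX_lead flatten_indexKl // nth_len.
by rewrite ltn_mod len_gt0.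
Qed.

Lemma cyc_lead r : cyc (lead r) = r.
Proof. by have := cyc_nuX_lead r 0; rewrite expg0 perm1. Qed.

Lemma nuX_lead_cyc i : i = (nu X ^+ reshape_offset (len X) i)%g (lead (cyc i)).
Proof.
apply: val_inj; rewrite /= nuX_lead modn_small ?reshape_indexK //.
by rewrite -nth_len reshape_offsetP.
Qed.

Lemma mem_porbit_lead r i : (i \in porbit (nu X) (lead r)) = (cyc i == r).
Proof.
apply/idP/eqP => [/porbitP[j ->]|<-]; first exact: cyc_nuX_lead.
by rewrite [X in X \in _]nuX_lead_cyc mem_porbit.
Qed.

Lemma nuX_lead_eq r s j : ((nu X ^+ j)%g (lead r) == lead s) = (r == s) && (l r %| j)%N.
Proof.
apply/eqP/andP => [E|[/eqP<- rj]].
  have rs : r = s by rewrite -(cyc_nuX_lead r j) E cyc_lead.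
  split; first exact/eqP; have := nuX_lead r j; rewrite E -rs => /addnI/esym.
  by move/eqP.
by apply: val_inj; rewrite /= nuX_lead (eqP rj).
Qed.

Lemma nuX_order : (nu X ^+ nu_order X = 1)%g.
Proof. exact: expg_order. Qed.

Lemma len_dvd_order r : (l r %| nu_order X)%N.
Proof.
suff : (r == r) && (l r %| nu_order X)%N by case/andP.
by rewrite -nuX_lead_eq nuX_order perm1.
Qed.

Lemma len_dvd_period r : (l r %| period X)%N.
Proof. by rewrite /period -muln2 dvdn_mulr // len_dvd_order. Qed.

Lemma period_gt0 : (0 < period X)%N.
Proof. by rewrite double_gt0 order_gt0. Qed.

Lemma period_len_gt0 r : (0 < period X %/ l r)%N.
Proof. by rewrite divn_gt0 ?len_gt0 // dvdn_leq ?period_gt0 ?len_dvd_period. Qed.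

End Cycles.

Section BilinearForm.

Variables (A : comPzRingType) (D : nat) (G : 'M[int]_D).

Lemma bformC (a b : 'rV[A]_D) : G^T = G -> bform G a b = bform G b a.
Proof.
move=> Gsym; rewrite /bform; transitivity ((a *m map_mx intr G *m b^T)^T 0 0).
  by rewrite [RHS]mxE.
by rewrite !trmx_mul trmxK map_trmx Gsym mulmxA.
Qed.

Lemma bformZl c (a b : 'rV[A]_D) : bform G (c *: a) b = c * bform G a b.
Proof. by rewrite /bform -!scalemxAl mxE. Qed.

Lemma bformNl (a b : 'rV[A]_D) : bform G (- a) b = - bform G a b.
Proof. by rewrite -scaleN1r bformZl mulN1r. Qed.

Lemma bform_suml (I : Type) (r : seq I) (P : pred I) (F : I -> 'rV[A]_D) b :
  bform G (\sum_(i <- r | P i) F i) b = \sum_(i <- r | P i) bform G (F i) b.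
Proof. by rewrite /bform !mulmx_suml summxE. Qed.

Lemma bform0l (b : 'rV[A]_D) : bform G 0 b = 0.
Proof. by rewrite /bform !mul0mx mxE. Qed.

Lemma bform_map_intr (a b : 'rV[int]_D) :
  bform G (map_mx intr a) (map_mx intr b) = (bform G a b)%:~R :> A.
Proof.
rewrite /bform map_trmx (_ : map_mx intr G = map_mx intr (map_mx intr G : 'M[int]_D)).
  by rewrite -!map_mxM [LHS]mxE.
by apply/matrixP => i j; rewrite !mxE intz.
Qed.

End BilinearForm.

Section Form.

Variables (X : twisted_lattice) (A : comPzRingType).

Implicit Types a b : 'rV[A]_(rk X).

Lemma bform_pact a b :
  bform (gram X) (pact (nu X) a) (pact (nu X) b) = bform (gram X) a b.
Proof.
rewrite /bform /pact trmx_mul tr_perm_mx !mulmxA -[a *m _ *m _]mulmxA -row_permE.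
rewrite -[_ *m _ *m perm_mx _]mulmxA -col_permE; congr ((_ *m _ *m _) 0 0).
by apply/matrixP => i j; rewrite !mxE nu_isometry.
Qed.

Lemma pact1 a : pact 1%g a = a.
Proof. by rewrite /pact perm_mx1 mulmx1. Qed.

Lemma pactM (s t : 'S_(rk X)) a : pact (s * t)%g a = pact t (pact s a).
Proof. by rewrite /pact perm_mxM mulmxA. Qed.

Lemma bform_pactX j a b :
  bform (gram X) (pact (nu X ^+ j)%g a) (pact (nu X ^+ j)%g b) = bform (gram X) a b.
Proof.
elim: j => [|j IH]; first by rewrite expg0 !pact1.
by rewrite expgSr !pactM bform_pact.
Qed.

Lemma pact_simple (s : 'S_(rk X)) i : pact s (simple i) = simple (s i).
Proof.
by rewrite /pact /simple -rowE; apply/rowP => j; rewrite !mxE eqxx eq_sym.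
Qed.

End Form.

(** * Projections to the eigenspaces of nu *)

Section Projection.

Variables (R : realType) (X : twisted_lattice) (eta : R[i]).
Hypothesis eta_prim : (period X).-primitive_root eta.

Local Notation C := R[i].
Local Notation k := (period X).
Local Notation h := 'rV[C]_(rk X).

Lemma period_neq0 : (k%:R : C) != 0.
Proof. by rewrite pnatr_eq0 -lt0n period_gt0. Qed.

Lemma eta_neq0 : eta != 0.
Proof.
apply: contra_eq_neq (prim_expr_order eta_prim) => ->.
by rewrite expr0n eqn0Ngt period_gt0 eq_sym oner_eq0.
Qed.

Lemma toh_pact (s : 'S_(rk X)) (a : lattice X) : toh R (pact s a) = pact s (toh R a).
Proof. by rewrite /toh /pact map_mxM map_perm_mx. Qed.

Lemma tohD (a b : lattice X) : toh R (a + b) = toh R a + toh R b.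
Proof. exact: map_mxD. Qed.

Lemma tohN (a : lattice X) : toh R (- a) = - toh R a.
Proof. exact: map_mxN. Qed.

Lemma hformC (u v : h) : hform u v = hform v u.
Proof. by apply: bformC; apply: gram_sym. Qed.

Lemma hformDl (u v w : h) : hform (u + v) w = hform u w + hform v w.
Proof. exact: bformDl. Qed.

Lemma hformNl (u v : h) : hform (- u) v = - hform u v.
Proof. exact: bformNl. Qed.

Lemma hform_toh (a b : lattice X) : hform (toh R a) (toh R b) = (latform a b)%:~R.
Proof. exact: bform_map_intr. Qed.

Lemma hproj_linear n : linear (@hproj R X eta n).
Proof.
move=> c a b; rewrite /hproj [RHS]addrC scalerA mulrC -scalerA -scalerDr addrC.
congr (_ *: _); rewrite scaler_sumr -big_split; apply: eq_bigr => j _ /=.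
by rewrite /pact mulmxDl -scalemxAl scalerDr !scalerA [c * _]mulrC.
Qed.

HB.instance Definition _ n := GRing.isLinear.Build C h h *:%R
  (hproj eta n) (hproj_linear n).

Lemma hprojD n (a b : h) : hproj eta n (a + b) = hproj eta n a + hproj eta n b.
Proof. exact: linearD. Qed.

Lemma hproj_pact n (a : h) : hproj eta n (pact (nu X) a) = eta ^ n *: hproj eta n a.
Proof.
have /eigenspaceP <- := hproj_sub n a (prim_expr_order eta_prim).
rewrite /hproj -scalemxAl mulmx_suml; congr (_ *: _); apply: eq_bigr => j _.
by rewrite -scalemxAl /pact -!mulmxA -!perm_mxM -expgS -expgSr.
Qed.

Lemma hproj_pactX n j (a : h) :
  hproj eta n (pact (nu X ^+ j)%g a) = eta ^ (n * j%:Z) *: hproj eta n a.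
Proof.
elim: j => [|j IH]; first by rewrite mulr0 expr0z scale1r expg0 pact1.
rewrite expgSr pactM hproj_pact IH scalerA -expfzDr ?eta_neq0 //.
by congr (_ ^ _ *: _); rewrite -addn1 PoszD mulrDr mulr1 addrC.
Qed.

(** nu^l fixes the leader of a cycle of length l, but acts on h_(n) as eta^(n l), which is not 1
    under this hypothesis. *)
Lemma hproj_simple_eq0 n (r : 'I_(ncyc X)) : ~~ (k %| `|n| * tnth (len X) r)%N ->
  hproj eta n (toh R (simple (lead r))) = 0.
Proof.
move=> nr; pose l := tnth (len X) r; apply/eqP.
have : (eta ^ (n * l%:Z) - 1) *: hproj eta n (toh R (simple (lead r))) == 0.
  rewrite scalerBl scale1r -hproj_pactX -toh_pact pact_simple.
  suff -> : (nu X ^+ l)%g (lead r) = lead r by rewrite subrr.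
  by apply/eqP; rewrite nuX_lead_eq eqxx dvdnn.
rewrite scaler_eq0 subr_eq0 => /orP[|//] e1; case/negP: nr.
rewrite (prim_order_dvd eta_prim) -/l; move: e1; case: n => n /=.
  by rewrite -PoszM.
by rewrite NegzE mulNr -PoszM -exprnN invr_eq1.
Qed.

(* The coefficient of h_(n) at the leader of another cycle vanishes, so that
   the coefficients at the leaders separate the cycles. *)
Lemma hproj_simple_lead n (r s : 'I_(ncyc X)) : (k %| `|n| * tnth (len X) r)%N ->
  hproj eta n (toh R (simple (lead r))) 0 (lead s) =
  (r == s)%:R * (k%:R^-1 * (\sum_(j < k) (tnth (len X) r %| j))%:R).
Proof.
move=> nr; rewrite /hproj mxE summxE [RHS]mulrCA natr_sum; congr (_ * _).
rewrite mulr_sumr; apply: eq_bigr => j _; rewrite mxE -toh_pact pact_simple.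
rewrite /toh /simple !mxE eqxx /= eq_sym nuX_lead_eq.
case: eqP => _ /=; last by rewrite mulr0 mul0r.
case: (boolP (_ %| j)%N) => [rj|_]; last by rewrite mulr0 mul1r.
rewrite mulr1 mul1r; suff : (eta ^+ (`|n| * j) = 1).
  case: n {nr} => n /=; first by rewrite -PoszM -exprnN => ->; rewrite invr1.
  by rewrite NegzE mulNr opprK -PoszM.
apply/eqP; rewrite -(prim_order_dvd eta_prim) (dvdn_trans nr) //.
exact: dvdn_mul.
Qed.

Lemma sum_len_neq0 (r : 'I_(ncyc X)) :
  k%:R^-1 * (\sum_(j < k) (tnth (len X) r %| j))%:R != 0 :> C.
Proof.
rewrite mulf_neq0 ?invr_eq0 ?period_neq0 // pnatr_eq0.
by rewrite (bigD1 (Ordinal (period_gt0 X))) //= dvdn0.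
Qed.

End Projection.

(** * The form on h_(0) and the exponent of q *)

Section ZeroModes.

Variables (R : realType) (X : twisted_lattice) (eta : R[i]).
Hypothesis eta_prim : (period X).-primitive_root eta.

Local Notation C := R[i].
Local Notation k := (period X).
Local Notation h := 'rV[C]_(rk X).
Local Notation L := (lattice X).

Implicit Types (a b : L) (s : seq 'I_(rk X)).

(** The integer k <a_(0), b_(0)>, by [kform_hproj]. *)
Definition kform a b : int := \sum_(j < k) latform (pact (nu X ^+ j)%g a) b.

(** Half of [kform a a] obtained without a division: nu^(k/2) = 1, so the two halves of that sum
    coincide. *)
Definition half_kform a : int := \sum_(j < nu_order X) latform (pact (nu X ^+ j)%g a) a.

(** nu preserves the form and fixes u, so all <u, nu^j v> are equal and so is their average. *)
Lemma hform_hspace0 (u v : h) : (u <= hspace X eta 0)%MS ->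
  hform u v = hform u (hproj eta 0 v).
Proof.
move=> /eigenspaceP; rewrite expr0z scale1r -/(pact _ u) => u0.
have hC (w w' : h) : hform w w' = hform w' w by apply: bformC; exact: gram_sym.
rewrite [RHS]hC [LHS]hC /hproj /hform bformZl bform_suml.
rewrite (eq_bigr (fun=> hform v u)) => [|j _]; last first.
  rewrite mul0r oppr0 expr0z scale1r /hform -[in RHS](bform_pactX j); congr bform.
  elim: (j : nat) => [|j' IH]; first by rewrite expg0 pact1.
  by rewrite expgSr pactM -IH u0.
by rewrite sumr_const card_ord -(mulr_natl (hform v u)) mulKf ?period_neq0.
Qed.

Lemma hform_hproj0 (u v : h) : hform (hproj eta 0 u) (hproj eta 0 v) = hform (hproj eta 0 u) v.
Proof. by rewrite [RHS]hform_hspace0 // hproj_sub // prim_expr_order. Qed.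

Lemma kformE a b : (kform a b)%:~R = k%:R * hform (hproj eta 0 (toh R a)) (toh R b).
Proof.
rewrite /hform /hproj bformZl mulVKf ?period_neq0 // bform_suml rmorph_sum.
apply: eq_bigr => j _; rewrite mul0r oppr0 expr0z scale1r -toh_pact.
exact/esym/hform_toh.
Qed.

Lemma kform_hproj a b :
  (kform a b)%:~R = k%:R * hform (hproj eta 0 (toh R a)) (hproj eta 0 (toh R b)).
Proof. by rewrite kformE hform_hproj0. Qed.

Lemma kformC a b : kform a b = kform b a.
Proof.
apply: (@intr_inj C).
rewrite (kform_hproj a b) (kform_hproj b a).
apply: congr1.
by apply: bformC; exact: gram_sym.
Qed.

Lemma kformDl a b c : kform (a + b) c = kform a c + kform b c.
Proof.
rewrite /kform -big_split; apply: eq_bigr => j _.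
by rewrite /latform /pact mulmxDl bformDl.
Qed.

Lemma kform_half a : kform a a = half_kform a *+ 2.
Proof.
rewrite /kform /period -addnn big_split_ord /= mulr2n; congr (_ + _).
by apply: eq_bigr => j _; rewrite expgD nuX_order mul1g.
Qed.

(** [half_kform] is a quadratic form with polar form [kform]; this is why the shifts of successive
    modes add up in [sum_shifts]. *)
Lemma half_kformD a b : half_kform (a + b) = half_kform a + half_kform b + kform a b.
Proof.
apply: (@mulIf int 2) => //; rewrite mulr_natr -kform_half kformDl [kform a _]kformC.
by rewrite [kform b _]kformC !kformDl [kform b a]kformC !kform_half; lia.
Qed.

Lemma half_kform_proj a b : hproj eta 0 (toh R a) = hproj eta 0 (toh R b) ->
  half_kform a = half_kform b.
Proof.
move=> ab; suff : kform a a = kform b b by rewrite !kform_half; lia.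
by apply: (@intr_inj C); rewrite (kform_hproj a a) (kform_hproj b b) ab.
Qed.

Lemma Nlat_hproj0 a : hproj eta 0 (toh R a) = 0 -> Nlat X eta a.
Proof.
move=> a0 u u0; rewrite /hform bformC ?gram_sym // -/(hform _ _) hform_hspace0 //.
by rewrite a0 /hform bformC ?gram_sym // bform0l.
Qed.

Definition wsum s : L := \sum_(i <- s) simple i.

Lemma wsum_cons i s : wsum (i :: s) = simple i + wsum s.
Proof. by rewrite /wsum big_cons. Qed.

Definition lead_sum (m : 'I_(ncyc X) -> nat) : L := \sum_r simple (lead r) *+ m r.

Definition cycs s (r : 'I_(ncyc X)) : nat := count (fun i => cyc i == r) s.

Lemma lead_sum_cons i s :
  lead_sum (cycs (i :: s)) = simple (lead (cyc i)) + lead_sum (cycs s).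
Proof.
rewrite /lead_sum (bigD1 (cyc i)) //= [in RHS](bigD1 (cyc i)) //=.
rewrite addrA -mulrS eqxx add1n; congr (_ + _); apply: eq_bigr => r ri.
by rewrite eq_sym (negPf ri).
Qed.

Lemma hproj0_simple (i : 'I_(rk X)) :
  hproj eta 0 (toh R (simple i)) = hproj eta 0 (toh R (simple (lead (cyc i)))).
Proof.
rewrite [in LHS](nuX_lead_cyc i) -pact_simple toh_pact hproj_pactX // mul0r expr0z.
by rewrite scale1r.
Qed.

Lemma toh0 : toh R (0 : L) = 0.
Proof. exact: map_mx0. Qed.

Lemma hproj0_wsum s :
  hproj eta 0 (toh R (wsum s)) = hproj eta 0 (toh R (lead_sum (cycs s))).
Proof.
elim: s => [|i s IH].
  congr (hproj _ _ (toh _ _)); rewrite /wsum big_nil /lead_sum big1 //.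
rewrite wsum_cons lead_sum_cons (tohD _ (simple i)) (tohD _ (simple _)).
by rewrite !hprojD IH hproj0_simple.
Qed.

Lemma half_kform_wsum s : half_kform (wsum s) = half_kform (lead_sum (cycs s)).
Proof. exact/half_kform_proj/hproj0_wsum. Qed.

Lemma half_kform_ge0 a : (forall j, 0 <= a 0 j) -> 0 <= half_kform a.
Proof.
move=> a0; apply: sumr_ge0 => j _; rewrite /latform /bform !mxE; apply: sumr_ge0 => i _.
rewrite mulr_ge0 // ?mxE //; apply: sumr_ge0 => i' _; rewrite mulr_ge0 // mxE.
  by apply: sumr_ge0 => i'' _; rewrite mulr_ge0 // !mxE.
by rewrite intz gram_ge0.
Qed.

Lemma half_kform_lead_sum_ge0 m : 0 <= half_kform (lead_sum m).
Proof.
apply: half_kform_ge0 => j; rewrite summxE sumr_ge0 // => r _.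
by rewrite mulmxnE mulrn_wge0 // mxE.
Qed.

Lemma half_kform_Amx m :
  let mv : 'rV[C]_(ncyc X) := \row_i (m i)%:R in
  (mv *m Amx X eta *m mv^T) 0 0 = (half_kform (lead_sum m) *+ 2)%:~R.
Proof.
rewrite -kform_half kform_hproj.
have -> : hproj eta 0 (toh R (lead_sum m)) =
    \sum_r (m r)%:R *: hproj eta 0 (toh R (simple (lead r))).
  rewrite /toh /lead_sum raddf_sum linear_sum; apply: eq_bigr => r _ /=.
  by rewrite raddfMn linearMn scaler_nat.
rewrite /hform bform_suml mulr_sumr mxE /=.
under eq_bigr do rewrite !mxE mulr_suml.
rewrite exchange_big; apply: eq_bigr => i _ /=.
rewrite bformZl bformC ?gram_sym // bform_suml mulrCA 2!mulr_sumr.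
apply: eq_bigr => j _; rewrite !mxE bformZl bformC ?gram_sym //.
by rewrite /hform; ring.
Qed.

End ZeroModes.

(** * The Fock space *)

Lemma leibniz_gen (K : pzRingType) (S : lalgType K) (D : {linear S -> S}) (gen : set S) :
    (forall P : S -> Prop, P 0 -> (forall u v, P u -> P v -> P (u + v)) ->
      (forall u, gen u -> P u) -> forall u, P u) ->
    (forall u v, gen u -> gen v -> D (u * v) = D u * v + u * D v) ->
  forall u v, D (u * v) = D u * v + u * D v.
Proof.
move=> gen_ind DM; apply: (gen_ind) => [v|u u' Hu Hu' v|u gu].
- by rewrite !(mul0r, linear0) addr0.
- by rewrite mulrDl !linearD /= Hu Hu' !mulrDl addrACA.
apply: (gen_ind) => [|v v' Hv Hv'|v gv].
- by rewrite !(mulr0, linear0) addr0.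
- by rewrite mulrDr !linearD /= Hv Hv' !mulrDr addrACA.
- exact: DM.
Qed.

Section FockDerivation.

Variables (R : realType) (X : twisted_lattice) (eta : R[i]).

Local Notation C := R[i].
Local Notation fock := {malg C[{cmonom (fock_var X eta)}]}.

Implicit Types (x : fock_var X eta) (w : fock).

Lemma divcm_ucm (u v : {cmonom (fock_var X eta)}) x :
  (0 < u x)%N -> (divcm u (ucm x) == v) = (u == mmul v (ucm x)).
Proof.
move=> ux; apply/eqP/eqP => [<-|->]; apply/eqP/cmP => y.
  by rewrite mulcmE divcmE subnK // ucmE; case: eqP => // <-.
by rewrite divcmE mulcmE addnK.
Qed.

(** [fock_deriv] sums over the support of its argument, which is not additive; linearity is read off
    from the coefficients instead. *)
Lemma mcoeff_fock_deriv x w v :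
  mcoeff v (fock_deriv x w) = mcoeff (mmul v (ucm x)) w *+ (v x).+1.
Proof.
have termE u : mcoeff v (mkmalgU (divcm u (ucm x)) (mcoeff u w *+ u x)) =
    if u == mmul v (ucm x) then mcoeff u w *+ (v x).+1 else 0.
  rewrite mcoeffU; case: (posnP (u x)) => [u0|ux].
    rewrite u0 mulr0n mul0rn; case: eqP => // uE.
    by move: u0; rewrite uE mulcmE ucmE eqxx addn1.
  rewrite divcm_ucm //; case: eqP => // ->.
  by rewrite mulr1n mulcmE ucmE eqxx addn1.
rewrite raddf_sum; rewrite (eq_bigr _ (fun u _ => termE u)).
case: (msuppP w (mmul v (ucm x))) => [wv|nwv].
  rewrite (bigD1_seq _ wv (fset_uniq _)) eqxx big1 => [|u /negPf-> //].
  exact: addr0.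
rewrite mul0rn big1_seq // => u /andP[_ uw].
by case: eqP => // uE; rewrite uE (negPf nwv) in uw.
Qed.

Opaque fock_deriv.

Lemma fock_deriv_linear x : linear (fock_deriv x).
Proof.
move=> a u v; apply/malgP => m; rewrite [LHS]mcoeff_fock_deriv mcoeffD mcoeffZ.
rewrite [RHS]mcoeffD [X in _ = X + _]mcoeffZ.
rewrite [X in _ = _ * X + _]mcoeff_fock_deriv [X in _ = _ + X]mcoeff_fock_deriv.
by rewrite mulrnDl mulrnAr.
Qed.

HB.instance Definition _ x := GRing.isLinear.Build C fock fock *:%R
  (fock_deriv x) (fock_deriv_linear x).

Lemma fock_derivU x (a : C) u :
  fock_deriv x (mkmalgU u a) = mkmalgU (divcm u (ucm x)) (a *+ u x).
Proof.
apply/malgP => v; rewrite mcoeff_fock_deriv !mcoeffU.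
case: (posnP (u x)) => [u0|ux].
  rewrite u0 mul0rn; case: eqP => [uE|_]; last by rewrite mul0rn.
  by move: u0; rewrite uE mulcmE ucmE eqxx addn1.
rewrite divcm_ucm //; case: eqP => [uE|_]; last by rewrite !mul0rn.
by rewrite !mulr1n uE mulcmE ucmE eqxx addn1.
Qed.

Lemma fock_ind (P : fock -> Prop) : P 0 -> (forall u v, P u -> P v -> P (u + v)) ->
  (forall a u, P (mkmalgU u a)) -> forall w, P w.
Proof. by move=> P0 PD PU w; rewrite (monalgE w); apply: (big_ind P). Qed.

Let malgMUU (a b : C) (u v : {cmonom (fock_var X eta)}) :
  mkmalgU u a * mkmalgU v b = mkmalgU (mmul u v) (a * b) :> fock.
Proof. by rewrite malgM_def; apply: fgmulUU. Qed.

Let fock_derivMU x (a b : C) (u v : {cmonom (fock_var X eta)}) :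
  fock_deriv x (mkmalgU u a * mkmalgU v b : fock) =
  fock_deriv x (mkmalgU u a) * mkmalgU v b + mkmalgU u a * fock_deriv x (mkmalgU v b).
Proof.
transitivity (fock_deriv x (mkmalgU (mmul u v) (a * b))).
  congr (fock_deriv x _); exact: malgMUU.
transitivity (mkmalgU (divcm u (ucm x)) (a *+ u x) * mkmalgU v b +
  mkmalgU u a * mkmalgU (divcm v (ucm x)) (b *+ v x) : fock); last first.
  exact: (congr2 +%R (congr1 (fun z => z * mkmalgU v b) (esym (fock_derivU x a u)))
    (congr1 (fun z => mkmalgU u a * z) (esym (fock_derivU x b v)))).
transitivity (mkmalgU (mmul (divcm u (ucm x)) v) (a *+ u x * b) +
  mkmalgU (mmul u (divcm v (ucm x))) (a * (b *+ v x)) : fock); last first.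
  exact: (congr2 +%R (esym (malgMUU _ _ _ _)) (esym (malgMUU _ _ _ _))).
transitivity (mkmalgU (divcm (mmul u v) (ucm x)) ((a * b) *+ mmul u v x) : fock).
  exact: fock_derivU.
have vE (s t : {cmonom (fock_var X eta)}) : (0 < s x)%N ->
    divcm (mmul s t) (ucm x) = mmul (divcm s (ucm x)) t.
  move=> sx; apply/eqP; rewrite divcm_ucm ?mulcmE ?addn_gt0 ?sx //; apply/eqP.
  have sE : s = mmul (divcm s (ucm x)) (ucm x).
    by apply/eqP; rewrite -(divcm_ucm _ sx).
  rewrite [in LHS]sE.
  by rewrite -!mulmA; congr mmul; apply: mulmC.
(* When x does not occur in s, the truncated quotients may differ, but the coefficient [c *+ s x] is
   then 0. *)
have vU (s t : {cmonom (fock_var X eta)}) (c : C) :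
    mkmalgU (divcm (mmul s t) (ucm x)) (c *+ s x) =
    mkmalgU (mmul (divcm s (ucm x)) t) (c *+ s x) :> fock.
  case: (posnP (s x)) => [->|sx]; last by rewrite vE.
  by rewrite mulr0n; transitivity (0 : fock); [|apply: esym]; apply: monalgU0.
rewrite mulcmE (mulrnDr (a * b)) (mulrnAl a b) (mulrnAr a b).
apply: etrans; first exact: monalgUD.
apply: congr2; first exact: vU.
by rewrite mulmC [mmul _ (divcm _ _)]mulmC; apply: vU.
Qed.

Lemma fock_derivM x (w w' : fock) :
  fock_deriv x (w * w') = fock_deriv x w * w' + w * fock_deriv x w'.
Proof.
apply: (@leibniz_gen _ _ (fock_deriv x)
  [set w | exists u a, w = mkmalgU u a]) => [P P0 PD PU|].
  by apply: fock_ind => // a u; apply: PU; exists u, a.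
move=> _ _ [u [a ->]] [v [b ->]]; exact: fock_derivMU.
Qed.

Lemma fock_derivX x y : fock_deriv x (fockX y) = (x == y)%:R.
Proof.
apply: etrans; first exact: fock_derivU.
rewrite ucmE eq_sym; case: eqP => [->|_]; last exact: monalgU0.
rewrite (_ : divcm _ _ = mone); first exact: mpolyC1E.
by apply/eqP/cmP => z; rewrite divcmE subnn onecmE.
Qed.

End FockDerivation.

Section Combination.

Variables (K : comPzRingType) (S : comAlgType K) (J : finType) (c : J -> K) (b : K).
Variable d : J -> {linear S -> S}.

Definition lin_comb w : S := b *: \sum_j c j *: d j w.

Lemma lin_comb_linear : linear lin_comb.
Proof.
move=> x u v; transitivity (b *: (x *: \sum_j c j *: d j u + \sum_j c j *: d j v)).
  rewrite scaler_sumr -big_split; congr (_ *: _); apply: eq_bigr => j _ /=.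
  by rewrite linearP scalerDr !scalerA [x * _]mulrC.
by rewrite scalerDr !scalerA [x * _]mulrC -scalerA.
Qed.

Lemma lin_combM : (forall j u v, d j (u * v) = d j u * v + u * d j v) ->
  forall u v, lin_comb (u * v) = lin_comb u * v + u * lin_comb v.
Proof.
move=> dM u v; rewrite /lin_comb -scalerAl -scalerAr -scalerDr mulr_suml mulr_sumr.
rewrite -big_split; congr (_ *: _); apply: eq_bigr => j _ /=.
by rewrite dM scalerDr scalerAl scalerAr.
Qed.

Lemma lin_comb_mull (x : J -> S) w :
  b *: \sum_j c j *: (x j * w) = (b *: \sum_j c j *: x j) * w.
Proof.
rewrite -scalerAl mulr_suml; congr (_ *: _); apply: eq_bigr => j _.
by rewrite scalerAl.
Qed.

Lemma lin_comb_const (J' : finType) (c' : J' -> K) (b' : K) (x : J' -> S)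
    (y : J -> J' -> K) :
  (forall j j', d j (x j') = (y j j')%:A) ->
  lin_comb (b' *: \sum_j' c' j' *: x j') =
  (b * \sum_j c j * (b' * \sum_j' c' j' * y j j'))%:A.
Proof.
move=> dx; rewrite /lin_comb -scalerA; congr (_ *: _).
rewrite scaler_suml; apply: eq_bigr => j _; rewrite -scalerA; congr (_ *: _).
rewrite linearZ linear_sum -scalerA /=; congr (_ *: _).
rewrite scaler_suml; apply: eq_bigr => j' _.
by rewrite linearZ /= dx scalerA.
Qed.

End Combination.

(** * Heisenberg oscillators *)

Section Oscillators.

Variables (R : realType) (X : twisted_lattice) (eta : R[i]).

Local Notation C := R[i].
Local Notation k := (period X).
Local Notation h := 'rV[C]_(rk X).
Local Notation L := (lattice X).
Local Notation fock := {malg C[{cmonom (fock_var X eta)}]}.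

Implicit Types (a b : L) (n : nat) (w : fock).

Definition osc_coord n (a : h) (j : 'I_(\rank (hspace X eta (- n.+1%:Z)))) : C :=
  (a *m pinvmx (row_base (hspace X eta (- n.+1%:Z)))) 0 j.

(* The exponent of E^-(-a, x) is multiplication by \sum_n osc a n x^(n/k). *)
Definition osc a n : fock :=
  if n is n'.+1 then
    - (((- n%:Z)%:~R / k%:R)^-1) *:
      \sum_j @osc_coord n' (hproj eta (- n%:Z) (toh R a)) j *: fockX (@fvar R X eta n' j)
  else 0.

Lemma Eterm_neg a n w : Eterm a (- n%:Z) w = osc a n * w.
Proof.
case: n => [|n]; first by rewrite /osc mul0r; apply: scaler0.
exact: lin_comb_mull.
Qed.

Lemma Eterm_pos a n w : Eterm a n.+1%:Z w =
  @lin_comb C fock _ (fun j => n.+1%:R / k%:R * hform (hproj eta n.+1%:Z (toh R a))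
                       (row j (row_base (hspace X eta (- n.+1%:Z)))))
    (- (n.+1%:Z%:~R / k%:R)^-1) (fun j => fock_deriv (@fvar R X eta n j)) w.
Proof. by []. Qed.

Lemma Eterm_linear a n : (0 < n)%N -> linear (@Eterm R X eta a n%:Z).
Proof.
by case: n => // n _ c u v; rewrite (Eterm_pos a n u) (Eterm_pos a n v) Eterm_pos lin_comb_linear.
Qed.

Lemma Eterm_leibniz a n (w w' : fock) : (0 < n)%N ->
  Eterm a n%:Z (w * w') = Eterm a n%:Z w * w' + w * Eterm a n%:Z w'.
Proof.
case: n => // n _; rewrite (Eterm_pos a n w) (Eterm_pos a n w') Eterm_pos.
by apply: lin_combM => j; apply: fock_derivM.
Qed.

Lemma fock_deriv_fvar n m j j' :
  fock_deriv (@fvar R X eta n j) (fockX (@fvar R X eta m j')) =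
  (@fvar R X eta n j == fvar j')%:R%:A.
Proof. by rewrite fock_derivX scaler_nat. Qed.

(** The Heisenberg relation: a positive mode commutes with all negative modes except those of
    opposite index, where the commutator is a scalar. This is the hypothesis of
    [homog_derivation]. *)
Lemma Eterm_osc b n : (0 < n)%N -> exists c : L -> C, forall a m,
  Eterm b n%:Z (osc a m) = if m == n then (c a)%:A else 0.
Proof.
case: n => // n _; have /choice[c cE] : forall a, exists c : C,
    Eterm b n.+1%:Z (osc a n.+1) = c%:A.
  move=> a; rewrite Eterm_pos; eexists; apply: lin_comb_const => j j'.
  exact: fock_deriv_fvar.
exists c => a m; case: eqP => [->|]; first exact: cE.
case: m => [_|m mn].
  exact: linear_fun0 (Eterm_linear b (ltn0Sn n)).
rewrite Eterm_pos; apply: etrans; first apply: lin_comb_const => j j'.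
  exact: fock_deriv_fvar.
rewrite big1 ?mulr0 ?scale0r // => j _; rewrite big1 ?mulr0 // => j' _.
rewrite (_ : (_ == _) = false) ?mulr0 //; apply/negP => /eqP/(congr1 (@tag _ _)) /= nm.
by case: mn; rewrite nm.
Qed.

End Oscillators.

(** In the recursion at n, a term [g m * y (n - m)] with m < n has m or n - m not divisible by c, so
    only [g n] is left. *)
Lemma newton_inverse_dvd (S : pzRingType) (c : nat) (y g : nat -> S) : y 0%N = 1 ->
    (forall p, p%:R * y p = \sum_(1 <= n < p.+1) g n * y (p - n)%N) ->
    (forall p, ~~ (c %| p)%N -> y p = 0) ->
  forall n, ~~ (c %| n)%N -> g n = 0.
Proof.
move=> y0 gE yc; elim/ltn_ind => -[|n] IH; first by rewrite dvdn0.
move=> cn; have := gE n.+1; rewrite yc // mulr0 big_nat_recr //= subnn y0 mulr1.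
rewrite big_nat big1 ?add0r // => m /andP[_ mn].
have [cm|/(IH _ mn) ->] := boolP (c %| m)%N; last by rewrite mul0r.
by rewrite yc ?mulr0 // -(dvdn_addr _ cm) subnKC // ltnW.
Qed.

Section ExpChange.

Variables (K : numFieldType) (S : comAlgType K).
Implicit Types (a b : nat -> S).

Lemma expz_scale (z : K) a b : (forall n, b n = z ^+ n *: a n) ->
  forall p : nat, expz b p%:Z = z ^+ p *: expz a p%:Z.
Proof.
move=> ba; apply: expz_uniq => [|p]; first by rewrite expr0 scale1r expz0.
rewrite scalerA mulrC -scalerA pmulrn (@expz_newton _ _ _ _ p) // scaler_sumr.
apply: eq_big_nat => n /andP[_ np]; rewrite subzn // ba /= -scalerAl -scalerAr !scalerA.
by rewrite -mulrA -exprD subnKC // mulrC.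
Qed.

Lemma expz_dvd (c : nat) a : (forall n, ~~ (c %| n)%N -> a n = 0) ->
  forall p : nat, ~~ (c %| p)%N -> expz a p%:Z = 0.
Proof.
move=> ac; elim/ltn_ind => -[|p] IH; first by rewrite dvdn0.
have p0 : (p.+1%:R : K) != 0 by rewrite pnatr_eq0.
move=> cp; apply: (scalerI p0); rewrite scaler0 pmulrn (@expz_newton _ _ _ _ p.+1) //.
rewrite big_nat big1 // => n /andP[n0 np]; rewrite subzn //.
have [cn|/ac ->] := boolP (c %| n)%N; last by rewrite mul0r scaler0.
rewrite IH ?mulr0 ?scaler0 //; first by rewrite ltn_subrL n0.
by rewrite -(dvdn_addr _ cn) subnKC.
Qed.

End ExpChange.

Section MorphExp.

Variables (K : numFieldType) (S T : comAlgType K) (phi : S -> T).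
Hypotheses (phi_lin : linear phi) (phiM : {morph phi : u v / u * v}) (phi1 : phi 1 = 1).

Lemma morph_expz (a : nat -> S) (p : int) : phi (expz a p) = expz (phi \o a) p.
Proof.
pose F : {linear S -> T} := HB.pack phi (GRing.isLinear.Build _ _ _ _ _ phi_lin).
have FE : phi =1 F by [].
case: p => [p|p]; last by rewrite FE linear0.
apply/esym; move: p; apply: (expz_uniq (y := fun p : nat => phi (expz a p%:Z))).
  by rewrite expz0 phi1.
move=> p; rewrite FE -linearZ pmulrn (@expz_newton _ _ _ _ p) // linear_sum.
apply: eq_big_nat => n /andP[_ np]; rewrite subzn //= FE linearZ -FE.
by rewrite phiM.
Qed.

End MorphExp.

(** The universal property of the polynomial algebra on V. *)
Lemma malg_eval (V : choiceType) (K : comNzRingType) (S : comAlgType K) (v : V -> S) :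
  exists phi : {malg K[{cmonom V}]} -> S,
    [/\ linear phi, {morph phi : u w / u * w}, phi 1 = 1 &
        forall x, phi (mkmalgU (ucm x) 1) = v x].
Proof.
pose h (u : {cmonom V}) : S := \prod_(x <- finsupp u) v x ^+ u x.
(* Any larger index set gives the same product, so u, w and their product can be evaluated over a
   common one. *)
have hE (E : {fset V}) (u : {cmonom V}) : (finsupp u `<=` E)%fset -> h u = \prod_(x <- E) v x ^+ u x.
  move=> uE; rewrite /h (big_fset_incl _ uE) // => x _ xu.
  by rewrite fsfun_dflt ?expr0.
have hM : mmorphism h.
  split=> [u w|]; last by rewrite /h mdom1 big_seq_fset0.
  rewrite (hE (finsupp u `|` finsupp w)%fset u) ?fsubsetUl //.
  rewrite (hE (finsupp u `|` finsupp w)%fset w) ?fsubsetUr //.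
  rewrite /h mdomD -big_split; apply: eq_bigr => x _ /=.
  by rewrite mulcmE exprD.
pose H : {mmorphism {cmonom V} -> S} := HB.pack h (isMultiplicative.Build _ _ _ hM).
pose F : {rmorphism {malg K[{cmonom V}]} -> S} := mmap (in_alg S) H.
exists F; split=> [c u w|u w||x].
- have -> : F (c *: u + w) = F (c *: u) + F w by exact: rmorphD.
  have -> : F (c *: u) = c%:A * F u by exact: (mmapZ (f := in_alg S) (h := H)).
  by rewrite mulr_algl.
- exact: rmorphM.
- exact: rmorph1.
- apply: etrans (mmapU _ _) _; rewrite /= scale1r mul1r /h mdomU big_seq_fset1.
  by rewrite ucmE eqxx expr1.
Qed.

Lemma scale_sum_mul (K : pzRingType) (V : lmodType K) (J : finType) (x y : J -> K)
    (c : K) (g : V) :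
  ((\sum_j x j * y j) * c) *: g = \sum_j (x j * y j * c) *: g.
Proof. by rewrite mulr_suml scaler_suml. Qed.

(** * Algebraic independence of the exponential coefficients *)

Section Exponentials.

Variables (R : realType) (X : twisted_lattice) (eta : R[i]).
Hypothesis eta_prim : (period X).-primitive_root eta.

Local Notation C := R[i].
Local Notation k := (period X).
Local Notation h := 'rV[C]_(rk X).
Local Notation fock := {malg C[{cmonom (fock_var X eta)}]}.
Local Notation l r := (tnth (len X) r).

Implicit Types (a : lattice X) (r s : 'I_(ncyc X)) (i : 'I_(rk X)).

(** alpha^(r) has a component in h_(n) only if this number divides n: see [dvdn_step] and
    [hproj_simple_eq0]. *)
Definition step r : nat := k %/ l r.

Lemma dvdn_step r n : (k %| n * l r)%N = (step r %| n)%N.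
Proof.
rewrite -[X in (X %| _)%N](divnK (len_dvd_period r)) dvdn_pmul2r //.
exact: len_gt0.
Qed.

Lemma osc_coordZ n c (u : h) j : osc_coord (c *: u) j = c * @osc_coord R X eta n u j.
Proof. by rewrite /osc_coord -scalemxAl mxE. Qed.

Definition osc_vec n (u : h) : fock :=
  - (((- n.+1%:Z)%:~R / k%:R)^-1) *: \sum_j osc_coord u j *: fockX (@fvar R X eta n j).

Lemma oscS a n : osc eta a n.+1 = osc_vec n (hproj eta (- n.+1%:Z) (toh R a)).
Proof. by []. Qed.

Lemma osc_vecZ n c (u : h) : osc_vec n (c *: u) = c *: osc_vec n u.
Proof.
have gen (S : comAlgType C) (J : finType) b (x x' : J -> C) (y : J -> S) :
    (forall j, x' j = c * x j) ->
    b *: \sum_j x' j *: y j = c *: (b *: \sum_j x j *: y j).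
  move=> x'E; rewrite scalerA [c * b]mulrC -scalerA; congr (_ *: _).
  by rewrite scaler_sumr; apply: eq_bigr => j _; rewrite scalerA x'E.
by apply: gen => j; apply: osc_coordZ.
Qed.

Lemma osc_pactX j a n :
  osc eta (pact (nu X ^+ j)%g a) n = ((eta ^- 1) ^+ j) ^+ n *: osc eta a n.
Proof.
case: n => [|n]; first exact/esym/scaler0.
apply: (etrans (oscS _ _)); rewrite toh_pact (hproj_pactX eta_prim) osc_vecZ.
suff -> : eta ^ (- n.+1%:Z * j%:Z) = ((eta ^- 1) ^+ j) ^+ n.+1 by [].
by rewrite mulNr -PoszM -exprnN expr1 -exprM exprVn mulnC.
Qed.

Lemma osc_lead_eq0 r n : ~~ (step r %| n)%N -> osc eta (simple (lead r)) n = 0.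
Proof.
case: n => [|n] rn //; rewrite oscS hproj_simple_eq0 ?abszN ?dvdn_step //.
by rewrite -(scale0r (0 : h)) osc_vecZ; apply: scale0r.
Qed.

Lemma expz_osc_cyc i (p : nat) : expz (osc eta (simple i)) p%:Z =
  ((eta ^- 1) ^+ reshape_offset (len X) i) ^+ p
    *: expz (osc eta (simple (lead (cyc i)))) p%:Z.
Proof.
apply: expz_scale => n; rewrite -osc_pactX.
by rewrite [in LHS](nuX_lead_cyc i) pact_simple.
Qed.

Lemma expz_osc_lead_eq0 r (p : nat) : ~~ (step r %| p)%N ->
  expz (osc eta (simple (lead r))) p%:Z = 0.
Proof. by apply: expz_dvd => n; apply: osc_lead_eq0. Qed.

Definition pvar : choiceType := ('I_(ncyc X) * nat)%type.

Local Notation B := {malg C[{cmonom pvar}]}.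

Definition pgen r (p : nat) : B :=
  if p is 0%N then 1 else if (step r %| p)%N then mkmalgU (ucm (r, p)) 1 else 0.

(* S[nu] is mapped onto a polynomial algebra on the coefficients of the
   E^-(-alpha^(r), x), so that these are algebraically independent. *)
Lemma fock_to_pgen : exists phi : fock -> B,
  [/\ linear phi, {morph phi : u w / u * w}, phi 1 = 1 &
      forall r (p : nat), phi (expz (osc eta (simple (lead r))) p%:Z) = pgen r p].
Proof.
(* [g r n] is what n times the n-th oscillator of alpha^(r) must be sent to. *)
have /choice[g gE] : forall r, exists g : nat -> B, forall p,
    p%:R * pgen r p = \sum_(1 <= n < p.+1) g n * pgen r (p - n)%N.
  by move=> r; apply: newton_inverse.
have g0 r n : ~~ (step r %| n)%N -> g r n = 0.
  apply: (newton_inverse_dvd _ (gE r)) => // -[|p]; first by rewrite dvdn0.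
  by move=> /negPf rp; rewrite /pgen rp.
(* The coordinate of a nonzero projection of alpha^(r) at its own leader, by [hproj_simple_lead];
   [con] is the reciprocal of all the scalars that n times the oscillator picks up. *)
pose kap r : C := k%:R^-1 * (\sum_(j < k) (l r %| j))%:R.
pose con r n : C := (n%:R * (- (((- n%:Z)%:~R / k%:R)^-1) * kap r))^-1.
(* Linear in u and reading only the coordinates at the leaders, so it can be prescribed on an
   arbitrary basis of h_(-n) and still be evaluated at the projection of alpha^(r). *)
pose f n (u : h) : B := \sum_r (u 0 (lead r) * con r n) *: g r n.
pose v (x : fock_var X eta) : B :=
  f (tag x).+1 (row (tagged x) (row_base (hspace X eta (- (tag x).+1%:Z)))).
have [phi [phi_lin phiM phi1 phiv]] := malg_eval v.
exists phi; split=> // r.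
pose F : {linear fock -> B} := HB.pack phi (GRing.isLinear.Build _ _ _ _ _ phi_lin).
have phiZ c w : phi (c *: w) = c *: phi w.
  exact: (linearZ_LR F).
have phi_osc n : n%:R *: phi (osc eta (simple (lead r)) n) = if n is 0%N then 0 else g r n.
  case: n => [|n]; first by rewrite scale0r.
  have [rn|rn] := boolP (step r %| n.+1)%N; last first.
    by rewrite osc_lead_eq0 // g0 // (linear_fun0 phi_lin) scaler0.
  rewrite oscS; set u := hproj _ _ _; pose b : C := - (((- n.+1%:Z)%:~R / k%:R)^-1).
  (* u lies in h_(-n), hence is recovered from its coordinates in the chosen basis. *)
  have uE : u = u *m pinvmx (row_base (hspace X eta (- n.+1%:Z)))
                  *m row_base (hspace X eta (- n.+1%:Z)).
    by rewrite mulmxKpV // eq_row_base hproj_sub // prim_expr_order.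
  have uEs s : u 0 (lead s) =
      \sum_j osc_coord u j * row j (row_base (hspace X eta (- n.+1%:Z))) 0 (lead s).
    by rewrite [in LHS]uE mxE; apply: eq_bigr => j _; rewrite [row _ _ _ _]mxE.
  have -> : phi (osc_vec n u) = b *: f n.+1 u.
    rewrite -[phi]/(F : fock -> B) linearZ linear_sum; congr (_ *: _).
    rewrite /f (eq_bigr (fun s => \sum_j (osc_coord u j *
        row j (row_base (hspace X eta (- n.+1%:Z))) 0 (lead s) * con s n.+1) *: g s n.+1)).
      rewrite exchange_big; apply: eq_bigr => j _ /=; rewrite phiZ phiv scaler_sumr.
      by apply: eq_bigr => s _; rewrite scalerA mulrA.
    move=> s _; rewrite {1}[u 0 _]uEs; exact: scale_sum_mul.
  have uE' s : u 0 (lead s) = (r == s)%:R * kap r.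
    by rewrite /u hproj_simple_lead // abszN dvdn_step.
  rewrite /f (bigD1 r) //= big1 => [|s sr]; last first.
    by rewrite uE' eq_sym (negPf sr) !mul0r scale0r.
  rewrite addr0 uE' eqxx mul1r !scalerA.
  rewrite /con -/b.
  rewrite [X in X *: _](_ : _ = 1) ?scale1r //.
  have gen (x y z : C) : x * (y * z) != 0 -> x * (y * (z / (x * (y * z)))) = 1.
    by move=> nz; rewrite -[RHS](mulfV nz) !mulrA.
  apply: gen; apply: mulf_neq0; first by rewrite pnatr_eq0.
  apply: mulf_neq0; last exact: sum_len_neq0.
  by rewrite oppr_eq0 invr_eq0 mulf_neq0 ?intr_eq0 // invr_eq0 period_neq0.
move=> p; rewrite (morph_expz phi_lin phiM phi1); move: p; apply: expz_uniq => // p.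
rewrite scaler_nat -mulr_natl gE; apply: eq_big_nat => -[|n] // _.
by rewrite scalerAl /= phi_osc.
Qed.

End Exponentials.

(** * Partitions *)

(* A partition with at most m parts is encoded by the numbers c i of its columns
   of height i + 1, for i < m: its parts are the tail sums of c. *)
Section Tails.

Implicit Types (m a : nat) (c : nat -> nat) (s : seq nat).

Definition tail_sum m c a : nat := (\sum_(a <= i < m) c i)%N.

Lemma tail_sumS m c a : (a < m)%N -> tail_sum m c a = (c a + tail_sum m c a.+1)%N.
Proof. by move=> am; rewrite /tail_sum big_ltn. Qed.

Definition tail_sums m c : seq nat := [seq tail_sum m c a | a <- iota 0 m].

Lemma size_tail_sums m c : size (tail_sums m c) = m.
Proof. by rewrite size_map size_iota. Qed.

Lemma nth_tail_sums m c a : nth 0%N (tail_sums m c) a = tail_sum m c a.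
Proof.
have [am|ma] := ltnP a m; first by rewrite (nth_map 0%N) ?size_iota // nth_iota.
by rewrite nth_default ?size_tail_sums // /tail_sum big_geq.
Qed.

Lemma tail_sums_sorted m c : sorted geq (tail_sums m c).
Proof.
apply/(sortedP 0%N) => a; rewrite size_tail_sums => am; rewrite !nth_tail_sums.
by rewrite tail_sumS ?(ltnW am) // /geq /= leq_addl.
Qed.

Lemma tail_sums_inj m c c' : tail_sums m c = tail_sums m c' ->
  forall a, (a < m)%N -> c a = c' a.
Proof.
move=> E a am; have tE b : tail_sum m c b = tail_sum m c' b.
  by rewrite -!nth_tail_sums E.
by have := tE a; rewrite 2?(tail_sumS _ am) tE => /addIn.
Qed.

(** The cells of the diagram, counted by rows and by columns. *)
Lemma sum_tail_sums m c : sumn (tail_sums m c) = (\sum_(i < m) i.+1 * c i)%N.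
Proof.
rewrite sumnE big_map -[X in iota _ X]subn0 -/(index_iota 0 m).
elim: m => [|m IH]; first by rewrite big_ord0 big_geq.
rewrite big_ord_recr /= -IH big_nat_recr //= {2}/tail_sum big_nat1.
rewrite (eq_big_nat _ _ (F2 := fun a => (tail_sum m c a + c m)%N)).
  by rewrite big_split sum_nat_const_nat /= subn0 -addnA mulSn [(c m + _)%N]addnC.
by move=> a /andP[_ am]; rewrite /tail_sum big_nat_recr // ltnW.
Qed.

(** The number of columns of height i + 1; past the last part the default 0 gives the right
    difference. *)
Definition drops s i : nat := (nth 0 s i - nth 0 s i.+1)%N.

Lemma tail_sums_drops s : sorted geq s -> tail_sums (size s) (drops s) = s.
Proof.
move=> /(sortedP 0%N) ss; apply: (@eq_from_nth _ 0%N); rewrite size_tail_sums //.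
have tE d : forall a, (a + d)%N = size s -> tail_sum (size s) (drops s) a = nth 0%N s a.
  elim: d => [|d IH] a ad.
    by rewrite nth_default ?[tail_sum _ _ _]big_geq // -ad addn0.
  rewrite tail_sumS; last by rewrite -ad; lia.
  rewrite IH; last by rewrite -ad addSnnS.
  rewrite /drops subnK //; have [/ss//|sa] := ltnP a.+1 (size s).
  by rewrite [X in (X <= _)%N]nth_default.
by move=> a asz; rewrite nth_tail_sums (tE (size s - a)%N) // subnKC // ltnW.
Qed.

End Tails.

(** The monomial of a partition does not see zero parts; their number is recovered from the size. *)
Lemma perm_eq_size_count (s t : seq nat) : size s = size t ->
  (forall p, (0 < p)%N -> count_mem p s = count_mem p t) -> perm_eq s t.
Proof.
move=> st cE; apply/allP => p _ /=; apply/eqP; case: p => [|p]; last exact: cE.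
have E u : count_mem 0%N u = (size u - size [seq x <- u | 0 < x])%N.
  rewrite size_filter -(count_predC (pred1 0%N) u).
  rewrite (@eq_count _ (predC (pred1 0%N)) (fun x => 0 < x)%N) ?addnK // => x.
  by rewrite /= lt0n.
rewrite !E st; congr (_ - _)%N; apply: perm_size; apply/allP => q _ /=; apply/eqP.
rewrite !count_filter; case: q => [|q].
  by rewrite !(@eq_count _ _ pred0) ?count_pred0 // => -[].
rewrite (@eq_count _ _ (pred1 q.+1)) 1?[RHS](@eq_count _ _ (pred1 q.+1)) ?cE //.
  by move=> x /=; case: eqP => // ->.
by move=> x /=; case: eqP => // ->.
Qed.

Section TailSumBasis.

Variables (d : nat) (st : 'I_d -> nat) (m : 'I_d -> nat).
Hypothesis st_gt0 : forall r, (0 < st r)%N.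

Local Notation J := {r : 'I_d & 'I_(m r)}.

Implicit Types (r : 'I_d) (t : seq ('I_d * nat)).

Definition tag_ord r (i : 'I_(m r)) : J := Tagged (fun r => 'I_(m r)) i.

Definition cfun n (c : {ffun J -> 'I_n.+1}) r (i : nat) : nat :=
  if insub i is Some j then c (@tag_ord r j) : nat else 0%N.

Lemma cfunE n (c : {ffun J -> 'I_n.+1}) r (i : 'I_(m r)) :
  cfun c r i = c (tag_ord i).
Proof. by rewrite /cfun valK. Qed.

(** The degree of one column of height i + 1, which is also the exponent in the i-th factor of the
    q-Pochhammer symbol. *)
Definition cweight (j : J) : nat := (st (tag j) * (tagged j).+1)%N.

Lemma cweight_gt0 j : (0 < cweight j)%N.
Proof. by rewrite muln_gt0 st_gt0. Qed.

Definition parts n (c : {ffun J -> 'I_n.+1}) r : seq nat := tail_sums (m r) (cfun c r).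

Lemma sum_cweight n (c : {ffun J -> 'I_n.+1}) :
  (\sum_j cweight j * c j = \sum_r st r * sumn (parts c r))%N.
Proof.
rewrite [RHS](eq_bigr (fun r => \sum_(i < m r) st r * i.+1 * c (tag_ord i))%N); last first.
  move=> r _; rewrite sum_tail_sums big_distrr /=; apply: eq_bigr => i _.
  by rewrite cfunE mulnA.
rewrite sig_big_dep /=; apply: eq_bigr => -[r i] _ //.
Qed.

Lemma parts_inj n (c c' : {ffun J -> 'I_n.+1}) :
  (forall r, parts c r = parts c' r) -> c = c'.
Proof.
move=> E; apply/ffunP => -[r i]; apply: val_inj => /=.
have := tail_sums_inj (E r) (ltn_ord i).
by rewrite !cfunE.
Qed.

(** No column number exceeds the total degree, which is at most n, so [inord] truncates nothing and
    the finite type of the functions [c] is large enough. *)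
Lemma parts_exist n (P : 'I_d -> seq nat) :
    (forall r, size (P r) = m r) -> (forall r, sorted geq (P r)) ->
    (\sum_r st r * sumn (P r) <= n)%N ->
  exists c : {ffun J -> 'I_n.+1}, forall r, parts c r = P r.
Proof.
move=> szP sP Pn; exists [ffun j : J => inord (drops (P (tag j)) (tagged j))] => r.
rewrite -[RHS](tail_sums_drops (sP r)) szP; apply: eq_map => a.
rewrite /tail_sum; apply: eq_big_nat => i /andP[_ im].
have := cfunE [ffun j : J => inord (drops (P (tag j)) (tagged j)) : 'I_n.+1] (Ordinal im).
rewrite /= => ->; rewrite ffunE /= inordK // ltnS.
apply: leq_trans Pn; rewrite (bigD1 r) //= -{2}[P r](tail_sums_drops (sP r)) szP.
apply: leq_trans (leq_addr _ _); apply: (leq_trans _ (leq_pmull _ (st_gt0 r))).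
rewrite sum_tail_sums (bigD1 (Ordinal im)) //=.
by apply: leq_trans (leq_addr _ _); apply: leq_pmull.
Qed.

Section Products.

Variables (S : comPzRingType) (H : 'I_d -> nat -> S).
Hypothesis H_eq0 : forall r p, ~~ (st r %| p)%N -> H r p = 0.

Definition parts_prod (P : 'I_d -> seq nat) : S :=
  \prod_r \prod_(p <- P r) H r (st r * p).

Lemma prod_parts n t :
    (forall r, count (fun x => x.1 == r) t = m r) -> (\sum_(x <- t) x.2 <= n)%N ->
  \prod_(x <- t) H x.1 x.2 = 0 \/
  exists2 c : {ffun J -> 'I_n.+1}, \prod_(x <- t) H x.1 x.2 = parts_prod (parts c) &
    (\sum_j cweight j * c j = \sum_(x <- t) x.2)%N.
Proof.
move=> tm tn; have [td|/allPn[x xt nx]] := boolP (all (fun x => st x.1 %| x.2)%N t); last first.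
  left; rewrite (big_rem x) //= H_eq0 ?mul0r //.
right; pose Q r := [seq (x.2 %/ st r)%N | x <- t & x.1 == r]; pose P r := sort geq (Q r).
have QP r : perm_eq (Q r) (P r) by rewrite perm_sym perm_sort.
have sumP : (\sum_r st r * sumn (P r) = \sum_(x <- t) x.2)%N.
  rewrite (partition_big (fun x => x.1) xpredT) //=; apply: eq_bigr => r _.
  rewrite -(perm_sumn (QP r)) sumnE big_map big_filter big_distrr /=.
  rewrite big_seq_cond [RHS]big_seq_cond; apply: eq_bigr => x /andP[xt /eqP xr].
  by rewrite mulnC -xr divnK // (allP td).
have [] := @parts_exist n P.
- by move=> r; rewrite size_sort size_map size_filter.
- by move=> r; apply: sort_sorted => a b; apply: leq_total.
- by rewrite sumP.
move=> c cP; exists c; last by rewrite sum_cweight -sumP; apply: eq_bigr => r _; rewrite cP.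
rewrite (partition_big (fun x => x.1) xpredT) //=; apply: eq_bigr => r _.
rewrite cP -(perm_big _ (QP r)) big_map big_filter.
rewrite big_seq_cond [RHS]big_seq_cond; apply: eq_bigr => x /andP[xt /eqP xr].
by rewrite mulnC -xr divnK // (allP td).
Qed.

End Products.

Definition parts_list n (c : {ffun J -> 'I_n.+1}) : seq ('I_d * nat) :=
  flatten [seq [seq (r, (st r * p)%N) | p <- parts c r] | r <- index_enum 'I_d].

Lemma big_parts_list n (c : {ffun J -> 'I_n.+1}) (T : Type) (idx : T)
    (op : Monoid.com_law idx) (F : 'I_d * nat -> T) :
  \big[op/idx]_(x <- parts_list c) F x =
  \big[op/idx]_r \big[op/idx]_(p <- parts c r) F (r, (st r * p)%N).
Proof. by rewrite big_flatten big_map; apply: eq_bigr => r _; rewrite big_map. Qed.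

Lemma count_parts_list n (c : {ffun J -> 'I_n.+1}) r :
  count (fun x => x.1 == r) (parts_list c) = m r.
Proof.
rewrite -sum1_count big_mkcond big_parts_list (bigD1 r) //=.
rewrite [X in (_ + X)%N]big1 => [|s /negPf sr]; last by rewrite sr big1_eq.
by rewrite eqxx addn0 sum1_size size_tail_sums.
Qed.

Lemma sum_parts_list n (c : {ffun J -> 'I_n.+1}) :
  (\sum_(x <- parts_list c) x.2 = \sum_j cweight j * c j)%N.
Proof.
rewrite big_parts_list sum_cweight; apply: eq_bigr => r _.
by rewrite sumnE big_distrr.
Qed.

End TailSumBasis.

Section MonomialIndependence.

Variables (K : comNzRingType) (d : nat) (st : 'I_d -> nat) (m : 'I_d -> nat).
Hypothesis st_gt0 : forall r, (0 < st r)%N.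

Local Notation J := {r : 'I_d & 'I_(m r)}.
Local Notation V := ('I_d * nat)%type.
Local Notation B := {malg K[{cmonom V}]}.

Variable pg : 'I_d -> nat -> B.
Hypothesis pg0 : forall r, pg r 0%N = 1.
Hypothesis pgS : forall r p, (0 < p)%N -> pg r (st r * p)%N = mkmalgU (ucm (r, st r * p)%N) 1.

Definition part_monom r p : {cmonom V} :=
  if p is 0%N then mone else ucm (r, st r * p)%N.

Definition parts_monom (P : 'I_d -> seq nat) : {cmonom V} :=
  \big[mmul/mone]_r \big[mmul/mone]_(p <- P r) part_monom r p.

Let U (u : {cmonom V}) : B := mkmalgU u 1.

Let U1 : U mone = 1.
Proof. exact: mpolyC1E. Qed.

Let UM u v : U (mmul u v) = U u * U v.
Proof.
apply/esym; rewrite /U malgM_def; apply: etrans; first exact: fgmulUU.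
exact: (congr1 (mkmalgU _) (mulr1 _)).
Qed.

Lemma parts_prod_monom P : parts_prod st pg P = mkmalgU (parts_monom P) 1.
Proof.
rewrite -/(U _) /parts_monom (big_morph U UM U1); apply: eq_bigr => r _.
rewrite (big_morph U UM U1); apply: eq_bigr => -[|p] _; last exact: pgS.
by rewrite muln0 pg0; apply/esym/U1.
Qed.

Lemma cmonom_big (I : Type) (s : seq I) (F : I -> {cmonom V}) x :
  (\big[mmul/mone]_(i <- s) F i) x = (\sum_(i <- s) F i x)%N.
Proof.
apply: (big_morph (fun u : {cmonom V} => u x)) => [u v|]; first exact: cmM.
exact: cm1.
Qed.

Lemma parts_monomE P r p : (0 < p)%N ->
  parts_monom P (r, st r * p)%N = count_mem p (P r).
Proof.
move=> p0; have partE s q : part_monom s q (r, st r * p)%N = (s == r) && (q == p) :> nat.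
  case: q => [|q] /=; first by rewrite cm1 (ltn_eqF p0) andbF.
  rewrite cmU xpair_eqE; case: eqP => //= ->.
  by rewrite eqn_pmul2l.
rewrite cmonom_big (bigD1 r) //= [X in (_ + X)%N]big1 => [|s /negPf sr].
  rewrite addn0 cmonom_big -sum1_count [RHS]big_mkcond; apply: eq_bigr => q _.
  by rewrite partE eqxx /=; case: eqP.
by rewrite cmonom_big big1 // => q _; rewrite partE sr.
Qed.

Lemma parts_monom_inj n (c c' : {ffun J -> 'I_n.+1}) :
  parts_monom (parts c) = parts_monom (parts c') -> c = c'.
Proof.
move=> E; apply: parts_inj => r; apply: (@sorted_eq _ geq).
- by move=> a b e ba ae; apply: leq_trans ae ba.
- by move=> a b; rewrite /geq /= andbC => /anti_leq.
- exact: tail_sums_sorted.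
- exact: tail_sums_sorted.
apply: perm_eq_size_count => [|p p0]; first by rewrite !size_tail_sums.
by rewrite -!parts_monomE // E.
Qed.

(** Different [c] give different monomials, so each scalar is a coefficient of the sum. *)
Lemma parts_prod_indep n (A : {pred {ffun J -> 'I_n.+1}}) (x : 'I_#|A| -> K) :
  \sum_i x i *: parts_prod st pg (parts (enum_val i)) = 0 -> forall i, x i = 0.
Proof.
move=> E i; have := congr1 (mcoeff (parts_monom (parts (enum_val i)))) E.
rewrite mcoeff0 raddf_sum (bigD1 i) //= big1 => [|j ji].
  rewrite addr0 parts_prod_monom; apply: etrans; rewrite mcoeffZ mcoeffUU.
  by rewrite mulr1.
rewrite parts_prod_monom; apply: etrans; first exact: mcoeffZ.
rewrite mcoeffU; case: eqP => [/parts_monom_inj/enum_val_inj ij|_]; last by rewrite mulr0n mulr0.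
by rewrite ij eqxx in ji.
Qed.

End MonomialIndependence.

(** * The twisted module *)

(** In [mode] the exponent left for x^(a_(0)) fixes p - q = M, and the degree of the vector bounds
    q, so the sum over all pairs is a finite sum over q. *)
Lemma fsum_diag (V : zmodType) (F : nat * nat -> V) (G : nat -> V) (M : int) (B : nat) :
    (forall p q : nat, p%:Z != M + q%:Z -> F (p, q) = 0) ->
    (forall p q : nat, (B <= q)%N -> F (p, q) = 0) ->
    (forall q : nat, M + q%:Z < 0 -> G q = 0) ->
    (forall p q : nat, p%:Z = M + q%:Z -> F (p, q) = G q) ->
  \sum_(pq \in [set: nat * nat]) F pq = \sum_(q < B) G q.
Proof.
move=> F0 FB G0 FG.
(* For M + q < 0 the listed pair is off the diagonal, and both F and G vanish there. *)
rewrite (fsbigE [seq (absz (M + q%:Z), q) | q <- index_iota 0 B]) //; first last.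
- move=> [p q] _; apply: contraNeq => Fpq.
  have pE : p%:Z = M + q%:Z by apply: contra_neq_eq Fpq; apply: F0.
  have qB : (q < B)%N by rewrite ltnNge; apply: contra_neqN Fpq => ?; rewrite FB.
  apply/mapP; exists q; first by rewrite mem_index_iota.
  by rewrite -pE absz_nat.
- by rewrite map_inj_uniq ?iota_uniq // => q q' [].
rewrite big_map big_mkord.
rewrite (eq_bigl xpredT) => [|q]; last by rewrite in_setT.
apply: eq_bigr => q _; case: (leP 0 (M + q%:Z)) => Mq.
  by rewrite FG // gez0_abs.
by rewrite G0 // F0 //; apply/eqP; lia.
Qed.

Lemma expo_eq (F : numFieldType) (k m K p q hf n : F) : k != 0 ->
  (K / k == - (m / k) - n - (p / k - q / k + hf *+ 2 / k / 2 - n)) =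
  (K == - m - p + q - hf).
Proof.
move=> k0; have -> : - (m / k) - n - (p / k - q / k + hf *+ 2 / k / 2 - n) =
  (- m - p + q - hf) / k by field; rewrite k0.
by rewrite (inj_eq (mulIf _)) // invr_eq0.
Qed.

Section Modes.

Variables (R : realType) (X : twisted_lattice) (eta : R[i]).
Hypothesis eta_prim : (period X).-primitive_root eta.
Variable tau : hatLnu X -> R[i].
Hypothesis tau_neq0 : forall n, hatN eta n -> tau n != 0.
Hypothesis tauM : forall n n' : hatLnu X,
  hatN eta n -> hatN eta n' -> tau (n * n')%g = tau n * tau n'.

Local Notation C := R[i].
Local Notation h := 'rV[C]_(rk X).
Local Notation fock := {malg C[{cmonom (fock_var X eta)}]}.

Implicit Types (g n : hatLnu X) (i : 'I_(rk X)) (w : fock) (s : seq 'I_(rk X)).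

Lemma barM g n : bar (g * n)%g = bar g + bar n.
Proof. by []. Qed.

Lemma barV g : bar g^-1%g = - bar g.
Proof. by []. Qed.

Lemma Nlat0 : Nlat X eta 0.
Proof. by move=> u _; rewrite toh0; apply: bform0l. Qed.

Lemma NlatN (a : lattice X) : Nlat X eta a -> Nlat X eta (- a).
Proof.
move=> Na u u0; rewrite tohN hformNl (Na u u0).
exact: oppr0.
Qed.

Lemma NlatD (a b : lattice X) : Nlat X eta a -> Nlat X eta b -> Nlat X eta (a + b).
Proof.
move=> Na Nb u u0; rewrite tohD hformDl (Na u u0) (Nb u u0).
exact: addr0.
Qed.

Lemma hatN1 : hatN eta (1%g : hatLnu X).
Proof. exact: Nlat0. Qed.

Lemma hatNM g n : hatN eta g -> hatN eta n -> hatN eta (g * n)%g.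
Proof. exact: NlatD. Qed.

Lemma hatNV g : hatN eta g -> hatN eta g^-1%g.
Proof. exact: NlatN. Qed.

Lemma tau1 : tau 1%g = 1.
Proof.
apply: (mulfI (tau_neq0 hatN1)); rewrite mulr1 -tauM ?mulg1 //; exact: hatN1.
Qed.

Lemma tauV n : hatN eta n -> tau n^-1%g = (tau n)^-1.
Proof.
move=> Nn.
by apply: (mulfI (tau_neq0 Nn)); rewrite mulfV ?tau_neq0 // -(tauM Nn (hatNV Nn)) mulgV tau1.
Qed.

(* psi g stands for the element g (x) 1 of U_T, and emb g w below for
   w (x) (g (x) 1). *)
Definition psi g (b : hatLnu X) : C :=
  if (g^-1 * b)%g \in hatN eta then (tau (g^-1 * b)%g)^-1 else 0.

Definition emb g w : hatLnu X -> fock := fun b => psi g b *: w.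

Lemma emb_linear g : linear (emb g).
Proof.
move=> c u v; apply/funext => b.
have gen (S : lmodType C) (x : C) (y z : S) : x *: (c *: y + z) = c *: (x *: y) + x *: z.
  by rewrite scalerDr !scalerA mulrC.
exact: gen.
Qed.

Lemma psi_id g : psi g g = 1.
Proof. by rewrite /psi mulVg mem_set ?tau1 ?invr1 //; apply: hatN1. Qed.

Lemma psiMr g n b : hatN eta n -> psi (g * n)%g b = tau n * psi g b.
Proof.
move=> Nn; rewrite /psi invMg -mulgA.
have NgE : ((n^-1 * (g^-1 * b))%g \in hatN eta) = ((g^-1 * b)%g \in hatN eta).
  apply/idP/idP => /set_mem H; apply/mem_set.
    by rewrite -[(g^-1 * b)%g](mulKVg n); apply: hatNM.
  exact: hatNM (hatNV Nn) H.
rewrite NgE; case: ifPn => [/set_mem H|_]; last by rewrite mulr0.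
by rewrite (tauM (hatNV Nn) H) (tauV Nn) invfM invrK.
Qed.

Lemma vacuum_emb : vacuum eta tau = emb 1%g 1.
Proof.
apply/funext => b; rewrite /vacuum /emb /psi invg1 mul1g.
by case: ifP => // _; apply/esym/scale0r.
Qed.

(** [psi g] is supported on the coset of g, whose elements differ from g by elements over N, and N
    is orthogonal to h_(0). Hence x^u acts on this vector through a single power of x. *)
Lemma psi_hform g b (u : h) : psi g b != 0 -> (u <= hspace X eta 0)%MS ->
  hform u (toh R (bar b)) = hform u (toh R (bar g)).
Proof.
rewrite /psi; case: ifPn => [/set_mem gb _|_]; last by rewrite eqxx.
move=> /gb; rewrite barM barV tohD tohN hformDl hformNl => /eqP.
by rewrite addrC subr_eq0 [hform u _]hformC [hform u _ in RHS]hformC => /eqP.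
Qed.

End Modes.

Lemma expo_eq_int (F : numFieldType) (k n : F) (K m hf : int) (p q : nat) : k != 0 ->
  (K%:~R / k == - (m%:~R / k) - n - (p%:R / k - q%:R / k + hf%:~R *+ 2 / k / 2 - n)) =
  (p%:Z == - m - (hf + K) + q%:Z).
Proof.
move=> k0; rewrite expo_eq // (_ : - m%:~R - p%:R + q%:R - hf%:~R =
  (- m - p%:Z + q%:Z - hf)%:~R); last by rewrite !(rmorphB, rmorphD, rmorphN).
by rewrite eqr_int; lia.
Qed.

Section ModeAction.

Variables (R : realType) (X : twisted_lattice) (eta : R[i]).
Hypothesis eta_prim : (period X).-primitive_root eta.

Local Notation C := R[i].
Local Notation k := (period X).
Local Notation h := 'rV[C]_(rk X).
Local Notation fock := {malg C[{cmonom (fock_var X eta)}]}.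

Implicit Types (g : hatLnu X) (i : 'I_(rk X)) (w : fock) (s : seq 'I_(rk X)).

Definition sosc i : nat -> fock := osc eta (simple i).
Definition sEplus i (n : nat) : fock -> fock := Eterm (simple i) n%:Z.

Lemma Eminus_expz (a : lattice X) p w : Eminus a p w = expz (osc eta a) p%:Z * w.
Proof.
rewrite /Eminus (_ : (fun n : nat => Eterm a (- n%:Z)) = fun (n : nat) w => osc eta a n * w).
  exact: exp_coef_mulE.
by apply/funext => n; apply/funext => u; apply: Eterm_neg.
Qed.

Lemma sEplus_linear i n : (0 < n)%N -> linear (sEplus i n).
Proof. exact: Eterm_linear. Qed.

Lemma sEplus_homog i n s N w : (0 < n)%N ->
  homog sosc s N w -> homog sosc s (N - n%:Z) (sEplus i n w).
Proof.
move=> n0; have [c cE] := Eterm_osc eta (simple i) n0.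
pose F : {linear fock -> fock} := HB.pack (sEplus i n)
  (GRing.isLinear.Build _ _ _ _ _ (sEplus_linear i n0)).
have FM u v : F (u * v) = F u * v + u * F v by exact: Eterm_leibniz.
have Fosc j m : F (sosc j m) = if m == n then (c (simple j))%:A else 0 by exact: cE.
exact: (homog_derivation FM n0 Fosc).
Qed.

Definition mode_scalar i : C :=
  k%:R ^ (- (latform (simple i) (simple i) %/ 2)%Z) * sigma eta (simple i).

Lemma mode_scalar_neq0 i : mode_scalar i != 0.
Proof.
rewrite mulf_neq0 ?expfz_neq0 ?period_neq0 //.
rewrite mulf_neq0 ?expfz_neq0 ?pnatr_eq0 // prodf_seq_neq0; apply/allP => j.
rewrite mem_index_iota => /andP[j0 jv] /=; rewrite expfz_neq0 // subr_eq0 eq_sym invr_eq1.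
rewrite -(prim_order_dvd eta_prim) gtnNdvd // /period -addnn.
by rewrite (leq_trans jv) // leq_addr.
Qed.

(* On S[nu] (x) e_(wsum s), the mode of index m is the coefficient of
   E^-(x) E^+(x) at this power of x^(1/k): the subtracted terms are the exponent
   k (<a_(0), a_(0)>/2 + <a_(0), wsum s>) contributed by x^(a_(0) + <a_(0), a_(0)>/2). *)
Definition mode_shift i s (m : int) : int :=
  - m - (half_kform (simple i) + kform (simple i) (wsum s)).

Variable tau : hatLnu X -> R[i].

Lemma EplusZ (a : lattice X) q c w : Eplus a q (c *: w) = c *: Eplus a q w.
Proof.
apply: linear_funZ; apply: exp_coef_linear => n n0; exact: Eterm_linear.
Qed.

Lemma Eminus_Eplus_scale (a : lattice X) p q c w :
  Eminus a p (Eplus a q (c *: w)) = c *: (expz (osc eta a) p%:Z * Eplus a q w).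
Proof. by rewrite Eminus_expz EplusZ; apply/esym/scalerAr. Qed.

Lemma xpow_emb g (u : h) e w b : (u <= hspace X eta 0)%MS ->
  xpow u e (emb tau g w) b = (if hform u (toh R (bar g)) == e then psi eta tau g b else 0) *: w.
Proof.
move=> u0; rewrite /xpow /emb; case: (eqVneq (psi eta tau g b) 0) => [->|gb].
  by rewrite scale0r !if_same scale0r.
by rewrite (psi_hform gb u0); case: ifP => // _; rewrite scale0r.
Qed.

Lemma translate_psi (a : hatLnu X) g b : psi eta tau g (a^-1 * b)%g = psi eta tau (a * g)%g b.
Proof. by rewrite /psi invMg mulgA. Qed.

(** The weight of g determines the power of x produced by x^(a_(0)), so the pairs that contribute
    satisfy p = M + q; those with q > N contribute 0, since E^+ would lower w to a negative
    degree. *)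
Lemma mode_emb i s m g N w : bar g = wsum s -> homog sosc s N w ->
  mode eta (simple i) m (emb tau g w) =
  emb tau ((sect (simple i) : hatLnu X) * g)%g
    (mode_scalar i *: vop sosc sEplus i (mode_shift i s m) N w).
Proof.
move=> gs Hw; apply/funext => b; rewrite /mode -/(mode_scalar i).
set M := mode_shift i s m; set P := psi eta tau ((sect (simple i) : hatLnu X) * g)%g b.
have u0 : (hproj eta 0 (toh R (simple i)) <= hspace X eta 0)%MS.
  by apply: hproj_sub; apply: prim_expr_order.
have kn0 : k%:R != 0 :> C by apply: period_neq0.
have hK : hform (hproj eta 0 (toh R (simple i))) (toh R (bar g)) =
    (kform (simple i) (wsum s))%:~R / k%:R.
  by rewrite (kformE eta) mulrC mulKf // gs.
have hH : hform (hproj eta 0 (toh R (simple i))) (hproj eta 0 (toh R (simple i))) =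
    (half_kform (simple i))%:~R *+ 2 / k%:R.
  have := kform_hproj eta_prim (simple i) (simple i); rewrite kform_half rmorphMn /= => ->.
  by rewrite mulrC mulKf.
pose nn : C := (latform (simple i) (simple i))%:~R / 2.
have xE (p q : nat) : translate (sect (simple i)) (xpow (hproj eta 0 (toh R (simple i)))
    (- (m%:~R / k%:R) - nn - (p%:R / k%:R - q%:R / k%:R +
       hform (hproj eta 0 (toh R (simple i))) (hproj eta 0 (toh R (simple i))) / 2 - nn))
    (emb tau g w)) b = (if p%:Z == M + q%:Z then P else 0) *: w.
  rewrite /translate (xpow_emb g _ _ _ u0) translate_psi hK hH.
  have condE := expo_eq_int nn (kform (simple i) (wsum s)) m (half_kform (simple i)) p q kn0.
  by rewrite condE.
have E0 (p q : nat) : Eminus (simple i) p (Eplus (simple i) q (0 *: w)) = 0.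
  by rewrite Eminus_Eplus_scale; apply: scale0r.
have gen (S : lmodType C) (I : finType) (c d : C) (x : I -> S) :
    c *: (\sum_j d *: x j) = d *: (c *: \sum_j x j).
  by rewrite -scaler_sumr !scalerA mulrC.
rewrite (@fsum_diag _ _ (fun q => P *: (expz (sosc i) (M + q%:Z)
  * exp_coef (sEplus i) q w)) M `|N|.+1); first exact: gen.
- move=> p q /negPf pq; rewrite (xE p q) pq; exact: E0.
- move=> p q qN; rewrite (xE p q) Eminus_Eplus_scale.
  rewrite (_ : Eplus _ _ _ = 0); first by rewrite mulr0; apply: scaler0.
  apply: (@homog_neg _ _ _ sosc s (N - q%:Z)); first by lia.
  exact: homog_exp_coef (fun n s N w => @sEplus_homog i n s N w) Hw q.
- by move=> q Mq; rewrite expz_neg // mul0r; apply: scaler0.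
- move=> p q pq; rewrite (xE p q) pq eqxx Eminus_Eplus_scale.
  by rewrite -pq.
Qed.

End ModeAction.

(** * The homogeneous components inside S[nu] *)

Section Components.

Variables (R : realType) (X : twisted_lattice) (eta : R[i]).
Hypothesis eta_prim : (period X).-primitive_root eta.
Variable tau : hatLnu X -> R[i].
Hypothesis tau_neq0 : forall n, hatN eta n -> tau n != 0.
Hypothesis tauM : forall n n' : hatLnu X,
  hatN eta n -> hatN eta n' -> tau (n * n')%g = tau n * tau n'.

Local Notation C := R[i].
Local Notation k := (period X).
Local Notation fock := {malg C[{cmonom (fock_var X eta)}]}.
Local Notation vopsX := (vops (@sosc R X eta) (@sEplus R X eta)).

Implicit Types (g : hatLnu X) (i : 'I_(rk X)) (w : fock) (s : seq 'I_(rk X)).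
Implicit Types (t : seq ('I_(rk X) * int)).

Definition sect_prod s : hatLnu X :=
  foldr (fun i g => (sect (simple i) : hatLnu X) * g)%g 1%g s.

Lemma bar_sect_prod s : bar (sect_prod s) = wsum s.
Proof.
elim: s => [|i s IH]; first by rewrite /wsum big_nil.
by rewrite wsum_cons -IH.
Qed.

Fixpoint shifts t : seq ('I_(rk X) * int) :=
  if t is (i, m) :: t' then (i, mode_shift i (map fst t') m) :: shifts t' else [::].

Lemma map_fst_shifts t : map fst (shifts t) = map fst t.
Proof. by elim: t => //= -[i m] t /= ->. Qed.

(** Each entry m becomes -m minus a number that depends on the lattice elements alone. Thus every
    list of degrees arises from a list of modes. *)
Lemma shiftsK : involutive shifts.
Proof.
elim=> //= -[i m] t IH /=; rewrite map_fst_shifts IH /mode_shift.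
by congr ((_, _) :: _); lia.
Qed.

Lemma half_kform0 : half_kform (0 : lattice X) = 0.
Proof. by rewrite /half_kform big1 // => j _; rewrite /latform /bform trmx0 mulmx0 mxE. Qed.

Lemma sum_shifts t :
  \sum_(x <- shifts t) x.2 = - (\sum_(x <- t) x.2) - half_kform (wsum (map fst t)).
Proof.
elim: t => [|[i m] t IH] /=.
  by rewrite /wsum !big_nil half_kform0 subr0 oppr0.
rewrite !big_cons IH wsum_cons (half_kformD eta_prim) /mode_shift /=; lia.
Qed.

Lemma monomial_vops t : exists2 c : C, c != 0 &
  monomial eta tau t = emb tau (sect_prod (map fst t)) (c *: vopsX (shifts t)).
Proof.
elim: t => [|[i m] t [c c0 IH]].
  exists 1; first exact: oner_neq0.
  rewrite -[LHS]/(vacuum eta tau) vacuum_emb.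
  exact: (congr1 (emb tau 1%g) (esym (scale1r _))).
exists (mode_scalar eta i * c); first by rewrite mulf_neq0 ?mode_scalar_neq0.
have HA := @sEplus_homog R X eta.
have Hw : homog (@sosc R X eta) (map fst t) (\sum_(x <- shifts t) x.2) (c *: vopsX (shifts t)).
  apply: subspaceZ; first exact: homog_subspace.
  by rewrite -(map_fst_shifts t); apply: vops_homog => *; apply: HA.
transitivity (mode eta (simple i) m (monomial eta tau t)); first reflexivity.
rewrite IH (mode_emb eta_prim tau i m (bar_sect_prod _) Hw).
have Hlin := vop_linear (@sosc R X eta) (@sEplus_linear R X eta) i
  (mode_shift i (map fst t) m) (\sum_(x <- shifts t) x.2).
apply: congr1; apply: etrans (scalerA _ _ _); apply: congr1.
exact: (linear_funZ c (vopsX (shifts t)) Hlin).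
Qed.

Definition lead_sect (m : 'I_(ncyc X) -> nat) : hatLnu X := sect (lead_sum m).

(** Lattice elements of equal charge have the same projection to h_(0), so their lifts differ by an
    element of hatN, which acts by a value of tau. All monomials of one charge therefore lie in a
    single copy of S[nu]. *)
Lemma emb_sect_prod s : exists2 d : C, d != 0 &
  forall w, emb tau (sect_prod s) w = emb tau (lead_sect (cycs s)) (d *: w).
Proof.
set g := lead_sect _; pose n := (g^-1 * sect_prod s)%g.
have Nn : hatN eta n.
  change (Nlat X eta (bar n)); apply: Nlat_hproj0.
  have -> : bar n = - lead_sum (cycs s) + wsum s by rewrite -bar_sect_prod.
  by rewrite tohD tohN hprojD (hproj0_wsum eta_prim) -hprojD addNr (linear_fun0 (hproj_linear eta 0)).
exists (tau n); first exact: tau_neq0.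
move=> w; apply/funext => b; rewrite /emb -(mulKVg g (sect_prod s)) -/n.
by rewrite (psiMr tau_neq0 tauM g b Nn) mulrC scalerA.
Qed.

Lemma chargeE t : charge t = cycs (map fst t).
Proof.
apply/funext => r; rewrite /charge /cycs count_map; apply: eq_count => x /=.
exact: mem_porbit_lead.
Qed.

Lemma wtE t (n : nat) : k%:R * (wt eta t - wt_vacuum X eta) = n%:R <->
  - \sum_(x <- t) x.2 = n%:Z.
Proof.
rewrite /wt addrK -mulr_suml mulrN mulrCA mulfV ?mulr1; last first.
  by rewrite pnatr_eq0 -lt0n period_gt0.
rewrite -rmorph_sum -rmorphN -[n%:R]/(n%:Z%:~R); split=> [|->] //.
exact: intr_inj.
Qed.

Definition charge_span (m : 'I_(ncyc X) -> nat) (N : int) : set fock :=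
  lin_span (prodz (@sosc R X eta) @`
    [set t | cycs (map fst t) = m /\ \sum_(x <- t) x.2 = N]).

Lemma homog_charge_span s N w :
  homog (@sosc R X eta) s N w -> charge_span (cycs s) N w.
Proof.
apply: lin_span_min; first exact: lin_span_subspace.
move=> _ [t [ts tN] <-]; apply: sub_lin_span; exists t => //.
by rewrite /= ts.
Qed.

Lemma WLT_componentE m (n : nat) : WLT_component eta tau m n =
  emb tau (lead_sect m) @` charge_span m (n%:Z - half_kform (lead_sum m)).
Proof.
have HA := @sEplus_homog R X eta.
have vops_span t : cycs (map fst t) = m ->
    exists2 c : C, c != 0 & monomial eta tau t = emb tau (lead_sect m) (c *: vopsX (shifts t)).
  move=> tm; have [c c0 ->] := monomial_vops t.
  have [d d0 dE] := emb_sect_prod (map fst t); rewrite dE tm scalerA.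
  by exists (d * c) => //; rewrite mulf_neq0.
have Nt t : cycs (map fst t) = m -> \sum_(x <- shifts t) x.2 =
    - (\sum_(x <- t) x.2) - half_kform (lead_sum m).
  by move=> tm; rewrite sum_shifts (half_kform_wsum eta_prim) tm.
rewrite -(lin_span_image _ (emb_linear tau _)); apply/seteqP; split.
  rewrite (lin_span_image _ (emb_linear tau _)) -/(charge_span _ _).
  apply: lin_span_min.
    rewrite -(lin_span_image _ (emb_linear tau _)); exact: lin_span_subspace.
  move=> _ [t [/funext tm tn] <-]; rewrite chargeE in tm.
  have [c c0 ->] := vops_span t tm; exists (c *: vopsX (shifts t)) => //.
  apply: subspaceZ; first exact: lin_span_subspace.
  have tn' : - \sum_(x <- t) x.2 = n%:Z by apply/wtE.
  rewrite -tn' -(Nt _ tm) -tm -(map_fst_shifts t).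
  by apply: homog_charge_span; apply: vops_homog => *; apply: HA.
(* Conversely, a product of H's is a combination of [vops] with the same indices, and [shifts] turns
   their degrees back into modes of monomials. *)
apply: lin_span_min; first exact: lin_span_subspace.
move=> _ [_ [t [tm tN] <-] <-].
have : homog (@sosc R X eta) (map fst t) (\sum_(x <- t) x.2) (prodz (@sosc R X eta) t).
  exact: homog_prodz.
have Hlin : forall i n, (0 < n)%N -> linear (@sEplus R X eta i n) by exact: sEplus_linear.
rewrite -(lin_span_vops Hlin (fun i n s N w => @HA i n s N w)).
have sW : subspace (WLT_component eta tau m n) by exact: lin_span_subspace.
apply: (@lin_span_min _ _ _ [set w | WLT_component eta tau m n (emb tau (lead_sect m) w)]).
  exact: subspace_preimage (emb_linear tau _) sW.
move=> _ [t' [t't t'N] <-] /=.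
have t'm : cycs (map fst (shifts t')) = m by rewrite map_fst_shifts t't.
have [c c0] := vops_span _ t'm; rewrite shiftsK => cE.
apply: (subspaceZ_inv sW c0); rewrite -(linear_funZ _ _ (emb_linear tau _)) -cE.
apply: sub_lin_span; exists (shifts t') => //; split; first by rewrite chargeE t'm.
by apply/wtE; have := Nt _ t'm; rewrite shiftsK t'N tN; lia.
Qed.

End Components.

(** * A basis of each component *)

Section Dimension.

Variables (R : realType) (X : twisted_lattice) (eta : R[i]).
Hypothesis eta_prim : (period X).-primitive_root eta.
Variables (m : 'I_(ncyc X) -> nat) (n e : nat).
Hypothesis en : (e <= n)%N.

Local Notation C := R[i].
Local Notation fock := {malg C[{cmonom (fock_var X eta)}]}.
Local Notation J := {r : 'I_(ncyc X) & 'I_(m r)}.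

Implicit Types (t : seq ('I_(rk X) * int)).

Definition lead_expz (r : 'I_(ncyc X)) (p : nat) : fock := expz (sosc eta (lead r)) p%:Z.

Definition comp_index : {pred {ffun J -> 'I_n.+1}} :=
  [pred c : {ffun J -> 'I_n.+1} | (\sum_j cweight (@step X) j * c j == n - e)%N].

Definition comp_basis (i : 'I_#|comp_index|) : fock :=
  parts_prod (@step X) lead_expz (parts (enum_val i)).

Lemma step_gt0 r : (0 < @step X r)%N.
Proof. exact: period_len_gt0. Qed.

Lemma prodz_lead t : (forall x, x \in t -> 0 <= x.2) -> exists z : C,
  prodz (sosc (R := R) (X := X) eta) t =
  z *: \prod_(x <- [seq (cyc x.1, absz x.2) | x <- t]) lead_expz x.1 x.2.
Proof.
have gen (S : comAlgType C) (z z' : C) (u v : S) : (z *: u) * (z' *: v) = (z * z') *: (u * v).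
  by rewrite -scalerAl -scalerAr scalerA.
elim: t => [|[i p] t IH] t0.
  by exists 1; rewrite /prodz !big_nil; apply/esym/scale1r.
have [x xt|z zE] := IH; first by apply: t0; rewrite in_cons xt orbT.
have := t0 (i, p); rewrite mem_head => /(_ isT) /=; case: p {t0} => // p _.
eexists; rewrite /prodz !big_cons -/(prodz _ t) zE [expz _ _](expz_osc_cyc eta_prim).
exact: gen.
Qed.

Lemma lin_span_comp_basis :
  lin_span (range comp_basis) = @charge_span R X eta m (n%:Z - e%:Z).
Proof.
apply/seteqP; split; apply: lin_span_min; try exact: lin_span_subspace.
  move=> _ [i _ <-]; set c : {ffun J -> 'I_n.+1} := enum_val i.
  have cE : (\sum_j cweight (@step X) j * c j = n - e)%N.
    by apply/eqP; have := enum_valP i; rewrite unfold_in.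
  apply: sub_lin_span.
  exists [seq (lead x.1, x.2%:Z) | x <- parts_list (@step X) c]; last first.
    by rewrite /prodz big_map big_parts_list.
  split; last first.
    rewrite big_map /= -(big_morph Posz PoszD (erefl _)).
    by rewrite sum_parts_list cE subzn.
  apply/funext => r; rewrite /cycs -map_comp count_map -(count_parts_list (@step X) c r).
  by apply: eq_count => x /=; rewrite cyc_lead.
move=> _ [t [tm tN] <-]; have [t0|] := boolP (all (fun x => 0 <= x.2) t); last first.
  move=> /allPn[x xt]; rewrite -ltNge => x0; rewrite (prodz_neg _ xt x0).
  by case: (lin_span_subspace (range comp_basis)).
have [z ->] := prodz_lead (fun x xt => allP t0 x xt).
apply: subspaceZ; first exact: lin_span_subspace.
pose t' := [seq (cyc x.1, absz x.2) | x <- t].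
have t'N : (\sum_(x <- t') x.2 = n - e)%N.
  have : (\sum_(x <- t') x.2)%N%:Z = n%:Z - e%:Z.
    rewrite (big_morph Posz PoszD (erefl _)) big_map -tN !big_seq.
    by apply: eq_bigr => x xt; apply: gez0_abs; apply: (allP t0).
  by rewrite subzn // => -[].
have t'm r : count (fun x => x.1 == r) t' = m r.
  by rewrite -tm /cycs count_map /t' count_map.
have H0 r p : ~~ (step r %| p)%N -> lead_expz r p = 0 by exact: expz_osc_lead_eq0.
have [|->|[c -> cN]] := prod_parts step_gt0 H0 t'm (n := n).
- by rewrite t'N leq_subr.
- by case: (lin_span_subspace (range comp_basis)).
have ci : c \in comp_index by rewrite unfold_in /= cN t'N.
apply: sub_lin_span; exists (enum_rank_in ci c) => //.
by rewrite /comp_basis enum_rankK_in.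
Qed.

Lemma comp_basis_indep (x : 'I_#|comp_index| -> C) :
  \sum_i x i *: comp_basis i = 0 -> forall i, x i = 0.
Proof.
have [phi [phi_lin phiM phi1 phiE]] := fock_to_pgen eta_prim.
pose F : {linear fock -> _} := HB.pack phi (GRing.isLinear.Build _ _ _ _ _ phi_lin).
have phi_prod P : phi (parts_prod (@step X) lead_expz P) = parts_prod (@step X) (@pgen R X) P.
  rewrite /parts_prod (big_morph phi phiM phi1); apply: eq_bigr => r _.
  by rewrite (big_morph phi phiM phi1); apply: eq_bigr => p _; apply: phiE.
move=> /(congr1 phi); rewrite (linear_fun0 phi_lin) => E.
have pg0 r : @pgen R X r 0 = 1 by [].
have pgS r p : (0 < p)%N ->
    @pgen R X r (step r * p)%N = mkmalgU (ucm (r, step r * p)%N) 1.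
  move=> p0; have [q E'] : exists q, (step r * p = q.+1)%N.
    by exists (step r * p).-1; rewrite prednK // muln_gt0 step_gt0.
  have dq : (step r %| q.+1)%N by rewrite -E' dvdn_mulr.
  rewrite E' /pgen dq; reflexivity.
apply: (parts_prod_indep step_gt0 pg0 pgS); apply: etrans E.
rewrite -[phi]/(F : fock -> _) linear_sum; apply: eq_bigr => i _.
apply: etrans (esym (linearZ_LR F _ _)); exact/congr1/esym/phi_prod.
Qed.

Lemma has_dim_charge_span : has_dim (@charge_span R X eta m (n%:Z - e%:Z)) #|comp_index|.
Proof.
exists comp_basis; split; [exact: lin_span_comp_basis|exact: comp_basis_indep].
Qed.

End Dimension.

Lemma charge_span_neg (R : realType) (X : twisted_lattice) (eta : R[i])
    (m : 'I_(ncyc X) -> nat) (N : int) :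
  N < 0 -> has_dim (@charge_span R X eta m N) 0.
Proof.
move=> N0; exists (fun=> 0); split=> [|c _ []//].
apply/seteqP; split; apply: lin_span_min; try exact: lin_span_subspace.
  by move=> u [[]].
move=> _ [t [_ tN] <-]; rewrite (_ : prodz _ _ = 0).
  by case: (lin_span_subspace (range (fun _ : 'I_0 => 0 : {malg R[i][{cmonom (fock_var X eta)}]}))).
apply: (@homog_neg _ _ _ (@sosc R X eta) (map fst t) N) => //.
by rewrite -tN; apply: homog_prodz.
Qed.

Theorem corollary4p2 (R : realType) (X : twisted_lattice) (eta : R[i])
    (eta_prim : (period X).-primitive_root eta)
    (NM : Nlat X eta = Mlat X) (NR : Nlat X eta = Rlat X eta)
    (nuhat : hatL X -> hatL X) (nuhatP : is_nuhat nuhat)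
    (tau : hatLnu X -> R[i]) (tauP : is_tau eta nuhat tau) :
  exists e : ('I_(ncyc X) -> nat) -> nat,
    [/\ forall m, let mv : 'rV[R[i]]_(ncyc X) := \row_i (m i)%:R in
          (e m)%:R = (mv *m Amx X eta *m mv^T) 0 0 / 2,
        forall m n, finite_dim (WLT_component eta tau m n) &
        forall m n, (chi' eta tau m n)%:Z =
          qfrac 'X^(e m)
            (\prod_(r < ncyc X)
               qpoch 'X^(period X %/ tnth (len X) r)
                     'X^(period X %/ tnth (len X) r) (m r)) n].
Proof.
have [tau_neq0 tauM _ _] := tauP.
pose e (m : 'I_(ncyc X) -> nat) := absz (half_kform (lead_sum m)).
have eE m : half_kform (lead_sum m) = (e m)%:Z.
  by rewrite gez0_abs // half_kform_lead_sum_ge0.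
pose J (m : 'I_(ncyc X) -> nat) : finType := {r : 'I_(ncyc X) & 'I_(m r)}.
pose D m n := if (e m <= n)%N then
  #|[pred c : {ffun J m -> 'I_n.+1} | (\sum_j cweight (@step X) j * c j == n - e m)%N]|
  else 0%N.
have WD m n : has_dim (WLT_component eta tau m n) (D m n).
  rewrite (WLT_componentE eta_prim tau_neq0 tauM) eE.
  apply: has_dim_image; first exact: emb_linear.
    move=> w /(congr1 (fun f => f (lead_sect m))) /=.
    rewrite /emb (psi_id tau_neq0 tauM) => w0; exact: etrans (esym (scale1r w)) w0.
  rewrite /D; case: leqP => [en|ne]; first exact: has_dim_charge_span.
  by apply: charge_span_neg; rewrite subr_lt0 ltz_nat.
exists e; split=> [m|m n|m n].
- move=> mv; have -> : (mv *m Amx X eta *m mv^T) 0 0 = (half_kform (lead_sum m) *+ 2)%:~R.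
    exact: half_kform_Amx.
  by rewrite eE rmorphMn /= -[_ *+ 2]mulr_natr mulfK ?pnatr_eq0.
- by exists (D m n).
rewrite /chi' (has_dimE (WD m n)) /D.
rewrite -(@qfrac_prod_geometric _ (cweight (m := m) (@step X)) (e m) n); last first.
  by move=> j; apply/cweight_gt0/step_gt0.
congr (qfrac _ _ n); rewrite /qpoch sig_big_dep /=; apply: eq_bigr => -[r i] _ /=.
by rewrite /cweight /= -exprM -exprD mulnS.
Qed.
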